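(* Let $M$ be a Riemann surface and let $y:M\to Q^4_1$ be a spacelike isothermic surface. If the left polar surface $[L]:M\to Q^4_1$ of $y$ is not degenerate, then $[L]$ is a spacelike isothermic surface, and if the right polar surface $[R]:M\to Q^4_1$ of $y$ is not degenerate, then $[R]$ is a spacelike isothermic surface. In particular, these surfaces share the same adapted coordinate: every adapted coordinate $z$ for $y$ is also an adapted coordinate for $[L]$ (respectively for $[R]$).
   Context: $\mathbb{R}^6_2$ is $\mathbb{R}^6$ with the quadratic form $\langle x,x\rangle=\sum_{i=1}^4x_i^2-x_5^2-x_6^2$ (extended complex-bilinearly to $\mathbb{C}^6$) and a fixed orientation; $C^5$ is its light cone, and $Q^4_1=\{[x]\in\mathbb{R}P^5: x\in C^5\setminus\{0\}\}$, with projection $\pi:C^5\setminus\{0\}\to Q^4_1$. All maps are smooth. A local lift of $y:M\to Q^4_1$ on an open set $U$ is a map $Y:U\to C^5\setminus\{0\}$ with $\pi\circ Y=y$; we write $y=[Y]$. Conformal spacelike surface: an immersion $y:M\to Q^4_1$ of a Riemann surface $M$ such that $\langle Y_z,Y_z\rangle=0$ and $\langle Y_z,Y_{\bar z}\rangle>0$ for any local lift $Y$ and any complex coordinate $z$. Then $M\times\mathbb{R}^6_2=V\oplus V^\perp$, where $V=\mathrm{Span}\{Y,\mathrm{Re}(Y_z),\mathrm{Im}(Y_z),Y_{z\bar z}\}$ is a Lorentzian rank-4 bundle, independent of the choice of $Y$ and $z$, and $V^\perp$ is a Lorentzian rank-2 bundle (the normal bundle). Canonical lift with respect to a local complex coordinate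 $z=u+\mathrm{i}v$: the local lift $Y$ (unique up to sign) with $|\mathrm{d}Y|^2=|\mathrm{d}z|^2$. With $Y$ canonical, $N\in\Gamma(V)$ is determined by $\langle N,Y_z\rangle=\langle N,Y_{\bar z}\rangle=\langle N,N\rangle=0$, $\langle N,Y\rangle=-1$. One has $Y_{zz}=-\frac{s}{2}Y+\kappa$ with a complex function $s$ (the Schwarzian derivative) and a section $\kappa$ of $V^\perp_{\mathbb{C}}=V^\perp\otimes\mathbb{C}$ (the conformal Hopf differential). A point is umbilic if $\kappa=0$ there. Isothermic: a conformal spacelike surface $y$ without umbilic points is called isothermic if around each point of $M$ there is a complex coordinate $z$ such that, for the canonical lift with respect to $z$, $\kappa$ is real-valued (i.e. $\kappa=\bar\kappa$). Such a $z$ is called an adapted coordinate. Polar surfaces: locally choose a frame $\{L,R\}$ of $V^\perp$ with $\langle L,L\rangle=\langle R,R\rangle=0$, $\langle L,R\rangle=-1$ and such that $\{Y,Y_u,Y_v,N,R,L\}$ is positively oriented in $\mathbb{R}^6_2$. The null lines $[L]$ and $[R]$ are then well defined, and the maps $[L],[R]:M\to Q^4_1$ are called the left and the right polar surface of $y=[Y]$, respectively. A polar surface is called non-degenerate if it is an immersion; writing $\kappa=\lambda_1L+\lambda_2R$, $[L]$ is degenerate exactly where $\lambda_2=0$ and $[R]$ exactly where $\lambda_1=0$. *)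

(* Defs.v *)
From mathcomp Require Export all_boot all_order all_algebra.
From mathcomp Require Export complex.
From mathcomp Require Export boolp classical_sets reals topology normedtype
  derive.

Set Implicit Arguments.
Unset Strict Implicit.
Unset Printing Implicit Defensive.

Import Order.TTheory GRing.Theory Num.Theory numFieldNormedType.Exports.

Local Open Scope classical_set_scope.
Local Open Scope ring_scope.

(* R[i] carries its topology and its normed module structure over itself only
   through the alias R[i]^o. *)
Notation Cplx R := (R[i]%C^o).


(* Only the values of [fwd] on [dom] and of [bwd] on [fwd @` dom] matter. *)
Record lchart (R : realType) (T : topologicalType) := LChart {
  dom : set T ;
  fwd : T -> Cplx R ;
  bwd : Cplx R -> T
}.

Record is_lchart (R : realType) (T : topologicalType) (z : lchart R T)
    : Prop := IsLChart {
  dom_open : open (dom z) ;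
  cod_open : open (fwd z @` dom z) ;
  fwdK : forall p, dom z p -> bwd z (fwd z p) = p ;
  fwd_continuous : forall p, dom z p -> {for p, continuous (fwd z)} ;
  bwd_continuous : forall c, (fwd z @` dom z) c -> {for c, continuous (bwd z)}
}.

(* [derivable] over the field R[i] is complex differentiability. *)
Definition holomorphic_transition (R : realType) (T : topologicalType)
    (z w : lchart R T) : Prop :=
  forall c : Cplx R, (fwd z @` (dom z `&` dom w)) c ->
    derivable (fwd w \o bwd z) c 1.

Definition compatible (R : realType) (T : topologicalType)
    (z w : lchart R T) : Prop :=
  holomorphic_transition z w /\ holomorphic_transition w z.

(* Second countability is automatic (Rado). *)
Record riemannSurface (R : realType) := RiemannSurface {
  rs_space :> topologicalType ;
  rs_hausdorff : hausdorff_space rs_space ;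
  rs_connected : connected [set: rs_space] ;
  rs_atlas : set (lchart R rs_space) ;
  rs_atlas_chart : forall z, rs_atlas z -> is_lchart z ;
  rs_atlas_cover : forall p, exists2 z, rs_atlas z & dom z p ;
  rs_atlas_compatible :
    forall z w, rs_atlas z -> rs_atlas w -> compatible z w
}.

(* Complex coordinates on open subsets of M: the charts of the maximal atlas. *)
Definition coordinate (R : realType) (M : riemannSurface R)
    (z : lchart R M) : Prop :=
  is_lchart z /\ forall w, rs_atlas w -> compatible z w.


Section Calculus.
Variables (R : realType) (M : riemannSurface R).
Implicit Types (z : lchart R M) (f : M -> 'rV[R]_6) (U : set M).

Definition u_line z f (p : M) (t : R) : 'rV[R]_6 :=
  f (bwd z (fwd z p + (t +i* 0)%C)).
Definition v_line z f (p : M) (t : R) : 'rV[R]_6 :=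
  f (bwd z (fwd z p + (0 +i* t)%C)).

Definition Du z f (p : M) : 'rV[R]_6 := derive1 (u_line z f p) 0.
Definition Dv z f (p : M) : 'rV[R]_6 := derive1 (v_line z f p) 0.

Fixpoint Ck z U (k : nat) f : Prop :=
  if k is k'.+1 then
    (forall p, U p -> derivable (u_line z f p) 0 1 /\
                      derivable (v_line z f p) 0 1) /\
    Ck z U k' (Du z f) /\ Ck z U k' (Dv z f)
  else forall p, U p -> {for p, continuous f}.

Definition smooth_on U f : Prop :=
  forall z, coordinate z -> forall k, Ck z (U `&` dom z) k f.

Definition cvec (a b : 'rV[R]_6) : 'rV[R[i]%C]_6 :=
  \row_j (a 0 j +i* b 0 j)%C.
Definition cpx (a : 'rV[R]_6) : 'rV[R[i]%C]_6 := cvec a 0.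
Definition rvec (x : 'rV[R[i]%C]_6) : 'rV[R]_6 := map_mx (@complex.Re R) x.
Definition ivec (x : 'rV[R[i]%C]_6) : 'rV[R]_6 := map_mx (@complex.Im R) x.
Definition conjv (x : 'rV[R[i]%C]_6) : 'rV[R[i]%C]_6 := map_mx (@conjc R) x.

Definition cDu z (F : M -> 'rV[R[i]%C]_6) (p : M) : 'rV[R[i]%C]_6 :=
  cvec (Du z (rvec \o F) p) (Du z (ivec \o F) p).
Definition cDv z (F : M -> 'rV[R[i]%C]_6) (p : M) : 'rV[R[i]%C]_6 :=
  cvec (Dv z (rvec \o F) p) (Dv z (ivec \o F) p).

Definition Dz z (F : M -> 'rV[R[i]%C]_6) (p : M) : 'rV[R[i]%C]_6 :=
  2^-1 *: (cDu z F p - 'i%C *: cDv z F p).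
Definition Dzbar z (F : M -> 'rV[R[i]%C]_6) (p : M) : 'rV[R[i]%C]_6 :=
  2^-1 *: (cDu z F p + 'i%C *: cDv z F p).

End Calculus.


(* Signature (4, 2), the last two coordinates being negative; used over R and,
   as its complex bilinear extension, over R[i]. *)
Definition form (K : comNzRingType) (x y : 'rV[K]_6) : K :=
  \sum_(j < 6) (-1) ^+ (4 <= j)%N * (x 0 j * y 0 j).

Definition light_cone (R : realType) : set 'rV[R]_6 :=
  [set x | form x x = 0].

(* A point of RP^5 is a line of R^6; the projection from the punctured light
   cone sends x to the line <[x]>. *)
Record quadric (R : realType) := Quadric {
  qline : {vspace 'rV[R]_6} ;
  qlineP : exists x : 'rV[R]_6,
    [/\ light_cone x, x != 0 & qline = <[x]>%VS]
}.

(* The i-th affine chart of RP^5: the representative with i-th coordinate 1. *)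
Definition aff_dom (R : realType) (i : 'I_6) (l : quadric R) : Prop :=
  vpick (qline l) 0 i != 0.
Definition aff (R : realType) (i : 'I_6) (l : quadric R) : 'rV[R]_6 :=
  (vpick (qline l) 0 i)^-1 *: vpick (qline l).

Section Surfaces.
Variables (R : realType) (M : riemannSurface R).
Implicit Types (y l : M -> quadric R) (z : lchart R M) (U : set M).
Implicit Types (Y L Rt : M -> 'rV[R]_6) (p : M).

Definition smooth_map y : Prop :=
  forall p, exists i U, [/\ open U, U p,
    (forall q, U q -> aff_dom i (y q)) & smooth_on U (aff i \o y)].

Definition immersion y : Prop :=
  smooth_map y /\
  forall z p i, coordinate z -> dom z p -> aff_dom i (y p) ->
    free [:: Du z (aff i \o y) p; Dv z (aff i \o y) p].

Definition local_lift y U Y : Prop :=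
  [/\ open U, smooth_on U Y &
    forall p, U p ->
      [/\ light_cone (Y p), Y p != 0 & qline (y p) = <[Y p]>%VS]].

(* In the order of R[i], 0 < x means that x is real and positive. *)
Definition conformal_spacelike y : Prop :=
  immersion y /\
  forall U Y z p, local_lift y U Y -> coordinate z -> U p -> dom z p ->
    form (Dz z (@cpx R \o Y) p) (Dz z (@cpx R \o Y) p) = 0 /\
    0 < form (Dz z (@cpx R \o Y) p) (Dzbar z (@cpx R \o Y) p).

(* Y_{z zbar} is real for smooth real Y, so taking its real part only changes
   its type. *)
Definition Dzzbar z Y p : 'rV[R]_6 :=
  rvec (Dzbar z (Dz z (@cpx R \o Y)) p).

Definition Vsp z Y p : {vspace 'rV[R]_6} :=
  <<[:: Y p; rvec (Dz z (@cpx R \o Y) p); ivec (Dz z (@cpx R \o Y) p);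
        Dzzbar z Y p]>>%VS.

Definition Vperp z Y p : set 'rV[R]_6 :=
  [set x | forall v, v \in Vsp z Y p -> form x v = 0].

Definition VperpC z Y p : set 'rV[R[i]%C]_6 :=
  [set x | Vperp z Y p (rvec x) /\ Vperp z Y p (ivec x)].

(* |dY|^2 = |dz|^2, evaluated on the tangent vector a d/du + b d/dv. *)
Definition canonical_lift y z U Y : Prop :=
  [/\ local_lift y U Y, U `<=` dom z &
    forall p, U p -> forall a b : R,
      let dY := a *: Du z Y p + b *: Dv z Y p in
      form dY dY = a ^+ 2 + b ^+ 2].

Definition normalN z Y p (N : 'rV[R]_6) : Prop :=
  N \in Vsp z Y p /\
  [/\ form (cpx N) (Dz z (@cpx R \o Y) p) = 0,
      form (cpx N) (Dzbar z (@cpx R \o Y) p) = 0,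
      form N N = 0 & form N (Y p) = -1].

(* s and kappa are the Schwarzian and the conformal Hopf differential at p of
   the canonical lift Y with respect to z. *)
Definition hopf z Y p (s : R[i]%C) (kappa : 'rV[R[i]%C]_6) : Prop :=
  VperpC z Y p kappa /\
  Dz z (Dz z (@cpx R \o Y)) p = - (s / 2) *: cpx (Y p) + kappa.

Definition umbilic y p : Prop :=
  exists z U Y s, [/\ coordinate z, canonical_lift y z U Y, U p &
    hopf z Y p s 0].

(* Canonical lifts with respect to z exist near every point of dom z, but not
   always on all of dom z, hence the quantification over U. *)
Definition adapted y z : Prop :=
  coordinate z /\
  forall U Y p s kappa, canonical_lift y z U Y -> U p ->
    hopf z Y p s kappa -> kappa = conjv kappa.

Definition isothermic y : Prop :=
  [/\ conformal_spacelike y, forall p, ~ umbilic y p &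
    forall p, exists2 z, adapted y z & dom z p].

(* o selects one of the two orientations of R^6; o = false is the standard
   one. *)
Definition positively_oriented (o : bool) (s : seq 'rV[R]_6) : Prop :=
  0 < (-1) ^+ o * \det (\matrix_(k < 6) s`_k).

Definition null_frame (o : bool) z U Y L Rt : Prop :=
  [/\ smooth_on U L, smooth_on U Rt &
    forall p, U p ->
      [/\ Vperp z Y p (L p), Vperp z Y p (Rt p),
          form (L p) (L p) = 0 /\ form (Rt p) (Rt p) = 0,
          form (L p) (Rt p) = -1 &
          exists2 N, normalN z Y p N &
            positively_oriented o
              [:: Y p; Du z Y p; Dv z Y p; N; Rt p; L p]]].

Definition left_polar (o : bool) y l : Prop :=
  forall p, exists z U Y L Rt,
    [/\ coordinate z, U p, canonical_lift y z U Y, null_frame o z U Y L Rt &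
      forall q, U q -> qline (l q) = <[L q]>%VS].

Definition right_polar (o : bool) y l : Prop :=
  forall p, exists z U Y L Rt,
    [/\ coordinate z, U p, canonical_lift y z U Y, null_frame o z U Y L Rt &
      forall q, U q -> qline (l q) = <[Rt q]>%VS].

End Surfaces.

(* Main.v *)
(** Let L be a lift of a polar surface and z a coordinate.  Everything rests on the
    relations <L,Y> = <L,Y_u> = <L,Y_v> = <L,Y_uu + Y_vv> = 0; by differentiation the
    last one is <L_u,Y_u> + <L_v,Y_v> = 0, which is conformally invariant by the
    first-order chain rule alone.  The plane orthogonal to Y, L, Y_u, Y_v is spanned by
    Y and L, so with m = <L_u,Y_u>, n = <L_u,Y_v> and r = |Y_u|^2 one gets, modulo
    Y and L,
      L_u = (m Y_u + n Y_v) / r,   L_v = (n Y_u - m Y_v) / r.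
    Where m = n = 0 the polar surface is not immersed; elsewhere it is conformal, and
    <L_zz,Y> = -(m - in)/2 <> 0 excludes umbilics.

    For canonical lifts, kappa is real iff the mixed derivative is proportional to
    the lift.  If Y_uv = s Y and L is canonical, then n = 0, m is a constant sign, and
      L_u = m Y_u + m g Y + g L,   L_v = - m Y_v - m g' Y + g' L;
    comparing L_uv with L_vu gives g_v = g'_u and the vanishing of the coefficient of Y
    in L_uv.  Left and right polar surfaces are treated alike, as null sections of the
    normal bundle. *)
From HB Require Import structures.
Require Import Defs.
From mathcomp Require Import realfun ring lra.
Set Implicit Arguments.
Unset Strict Implicit.
Unset Printing Implicit Defensive.

Import Order.TTheory GRing.Theory Num.Theory numFieldNormedType.Exports.

Local Open Scope classical_set_scope.
Local Open Scope ring_scope.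

(** * Two lemmas on functions of two real variables *)

(** Two features of the definitions shape the proof. A polar surface is given through canonical
    lifts in coordinates of its own choosing, whereas conformality and adaptedness concern every
    lift of it in prescribed coordinates [z]; the orthogonality relations must therefore travel
    between coordinates. That is why the relation with the Laplacian is traded for one of first
    order: carrying it over directly would bring in second derivatives of the transition map.
    Moreover, a local lift must be smooth in every coordinate, while transitions are only assumed
    complex differentiable. This matters for the factor 1/|Y_u| that makes a lift of the isothermic
    surface canonical in [z]: it is built from [z]-derivatives, and its smoothness elsewhere needs
    control of the transition. Reality of kappa is a condition on Y_uv because Y_zz = (Y_uu -
    Y_vv)/4 - i Y_uv/2, whence Im kappa = - Y_uv/2 + (Im s/2) Y; conversely, a multiple of Y that
    lies in V^perp vanishes. *)

Lemma MVT_origin (R : realType) (f df : R -> R) (h : R) :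
  (forall t, `|t| <= `|h| -> is_derive t (1 : R) f (df t)) ->
  exists2 c, `|c| <= `|h| & f h - f 0 = df c * h.
Proof.
move=> Hf.
have cont a b : `|a| <= `|h| -> `|b| <= `|h| -> {within `[a, b], continuous f}.
  move=> ah bh; apply: derivable_within_continuous => x; rewrite in_itv/= => /andP[ax xb].
  suff xh : `|x| <= `|h| by have [] := Hf x xh.
  by move: ah bh; rewrite !ler_norml => /andP[? ?] /andP[? ?]; apply/andP; split; lra.
have n0 : `|0 : R| <= `|h| by rewrite normr0.
(* [h] may be negative: in the chain rule it is the value of a coordinate function along a curve. *)
case: (lerP 0 h) => h0.
  have [|c cI E] := @MVT_segment R f df 0 h h0 _ (cont _ _ n0 (lexx _)).
    move=> x; rewrite in_itv/= => /andP[x0 xh]; apply: Hf.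
    by rewrite !ger0_norm // ltW.
  exists c; last by rewrite E subr0.
  by move: cI; rewrite in_itv/= => /andP[c0 ch]; rewrite !ger0_norm.
have [|c cI E] := @MVT_segment R f df h 0 (ltW h0) _ (cont _ _ (lexx _) n0).
  move=> x; rewrite in_itv/= => /andP[x0 xh]; apply: Hf.
  by rewrite !ltr0_norm //; lra.
exists c; last by lra.
move: cI; rewrite in_itv/= => /andP[c0 ch].
by rewrite (ltr0_norm h0) ler0_norm //; lra.
Qed.

Definition cont_origin (R : realType) (g : R -> R -> R) :=
  forall e : R, 0 < e -> exists2 d : R, 0 < d &
    forall x y, `|x| < d -> `|y| < d -> `|g x y - g 0 0| < e.

(** The mean value theorem is applied in x to [G x h - G x 0], then in y to [Gx x]. *)
Lemma second_difference (R : realType) (e h : R) (G Gx Gxy : R -> R -> R) :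
  (forall x y, `|x| < e -> `|y| < e -> is_derive x (1 : R) (G^~ y) (Gx x y)) ->
  (forall x y, `|x| < e -> `|y| < e -> is_derive y (1 : R) (Gx x) (Gxy x y)) ->
  0 < h -> h < e -> exists x y, [/\ `|x| <= h, `|y| <= h &
    G h h - G 0 h - G h 0 + G 0 0 = Gxy x y * h * h].
Proof.
move=> HGx HGxy h0 he.
have [|x xh Ex] := @MVT_origin R (fun x => G x h - G x 0) (fun x => Gx x h - Gx x 0) h.
  move=> t th; apply: is_deriveB; apply: HGx; rewrite ?normr0 //.
  - by apply: le_lt_trans th _; rewrite gtr0_norm.
  - by rewrite gtr0_norm.
  - by apply: le_lt_trans th _; rewrite gtr0_norm.
  - exact: lt_trans he.
rewrite (gtr0_norm h0) in xh.
have [|y yh Ey] := @MVT_origin R (Gx x) (Gxy x) h.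
  by move=> t th; apply: HGxy; [exact: le_lt_trans he|
    apply: le_lt_trans th _; rewrite gtr0_norm].
rewrite (gtr0_norm h0) in yh.
exists x, y; split => //.
by rewrite -Ey -Ex; ring.
Qed.

(** The second difference over a square is symmetric in the two variables, so a value of [Gxy] near
    the origin equals a value of [Gyx] near the origin; continuity there concludes. *)
Lemma Schwarz_plane (R : realType) (e : R) (G Gx Gy Gxy Gyx : R -> R -> R) :
  0 < e ->
  (forall x y, `|x| < e -> `|y| < e -> is_derive x (1 : R) (G^~ y) (Gx x y)) ->
  (forall x y, `|x| < e -> `|y| < e -> is_derive y (1 : R) (G x) (Gy x y)) ->
  (forall x y, `|x| < e -> `|y| < e -> is_derive y (1 : R) (Gx x) (Gxy x y)) ->
  (forall x y, `|x| < e -> `|y| < e -> is_derive x (1 : R) (Gy^~ y) (Gyx x y)) ->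
  cont_origin Gxy -> cont_origin Gyx -> Gxy 0 0 = Gyx 0 0.
Proof.
move=> e0 HGx HGy HGxy HGyx cxy cyx.
apply/eqP; rewrite -subr_eq0 -normr_le0; apply/ler_addgt0Pr => r r0; rewrite add0r.
have r20 : 0 < r / 2 by lra.
have [d d0 Hd] := cxy _ r20; have [d' d'0 Hd'] := cyx _ r20.
pose m := Num.min e (Num.min d d').
have m0 : 0 < m by rewrite /m !lt_min e0 d0 d'0.
have [me md md'] : [/\ m <= e, m <= d & m <= d'].
  by rewrite /m; split; rewrite !ge_min lexx ?orbT.
have h0 : 0 < m / 2 by lra.
have he : m / 2 < e by lra.
have [x [y [xh yh E]]] := second_difference HGx HGxy h0 he.
have [x' [y' [xh' yh' E']]] := @second_difference R e (m / 2) (fun x y => G y x)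
  (fun x y => Gy y x) (fun x y => Gyx y x) (fun x y a b => HGy y x b a)
  (fun x y a b => HGyx y x b a) h0 he.
have E2 : Gxy x y = Gyx y' x'.
  apply: (@mulIf _ (m / 2 * (m / 2))); first by rewrite mulf_neq0 // gt_eqF //; lra.
  by transitivity (G (m / 2) (m / 2) - G 0 (m / 2) - G (m / 2) 0 + G 0 0);
    [rewrite E; ring | have := E'; lra].
rewrite (_ : _ - _ = (Gyx y' x' - Gyx 0 0) - (Gxy x y - Gxy 0 0)); last by rewrite E2; ring.
apply: le_trans (ler_normB _ _) _; rewrite [leRHS]splitr lerD //; apply: ltW.
- by apply: Hd'; apply: (@le_lt_trans _ _ (m / 2)) => //; lra.
- by apply: Hd; apply: (@le_lt_trans _ _ (m / 2)) => //; lra.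
Qed.

Lemma is_derive0P (R : realType) (V : normedModType R) (f : R -> V) (d : V) :
  is_derive (0 : R) (1 : R) f d <->
  (fun h : R => h^-1 *: (f h - f 0)) @ 0^' --> d.
Proof.
have E : (fun h : R => h^-1 *: (f h - f 0)) =
         (fun h : R => h^-1 *: (f (h *: (1 : R) + 0) - f 0)).
  by apply/funext => h; rewrite addr0 /GRing.scale /= mulr1.
rewrite E; split=> [[dv <-]|H]; first exact: dv.
by apply: DeriveDef; [apply/cvg_ex; exists d|exact/cvg_lim].
Qed.

(** The increment is split as G(x,y) - G(0,y) plus G(0,y) - G(0,0). By the mean value theorem each
    part is a partial derivative at an intermediate point times x or y. *)
Lemma chain_plane (R : realType) (e : R) (G Gx Gy : R -> R -> R)
    (x y : R -> R) (a b : R) : 0 < e ->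
  (forall x y, `|x| < e -> `|y| < e -> is_derive x (1 : R) (G^~ y) (Gx x y)) ->
  (forall x y, `|x| < e -> `|y| < e -> is_derive y (1 : R) (G x) (Gy x y)) ->
  cont_origin Gx -> cont_origin Gy -> x 0 = 0 -> y 0 = 0 ->
  is_derive (0 : R) (1 : R) x a -> is_derive (0 : R) (1 : R) y b ->
  is_derive (0 : R) (1 : R) (fun t => G (x t) (y t)) (Gx 0 0 * a + Gy 0 0 * b).
Proof.
move=> e0 HGx HGy cGx cGy x0 y0 dx dy.
have small (w : R -> R) (c : R) : w 0 = 0 -> is_derive (0 : R) (1 : R) w c ->
    forall d : R, 0 < d -> \forall t \near 0^', `|w t| < d.
  move=> w0 [dw _] d d0; apply: cvg_within.
  have /differentiable_continuous wc : differentiable w (0 : R).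
    exact/derivable1_diffP.
  have /cvgrPdist_lt/(_ _ d0) : w t @[t --> (0 : R)] --> w 0 by exact: wc.
  by apply: filterS => t; rewrite w0 sub0r normrN.
have key (w H : R -> R) (k : R) (K : R -> R -> R) : w 0 = 0 ->
    is_derive (0 : R) (1 : R) w k -> cont_origin K ->
    (forall d, 0 < d -> \forall t \near 0^', exists x' y',
      [/\ `|x'| < d, `|y'| < d & H t = K x' y' * w t]) ->
    (fun t : R => t^-1 *: H t) @ 0^' --> K 0 0 * k.
  move=> w0 /is_derive0P dw cK HK.
  (* Where [w] vanishes so does [H]; giving the quotient the value [K 0 0] there keeps its limit. *)
  pose psi t := if w t == 0 then K 0 0 else H t / w t.
  have psic : psi @ 0^' --> K 0 0.
    apply/cvgrPdist_lt => r r0; have [d d0 Kd] := cK _ r0.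
    near=> t.
    have [x' [y' [xd yd Ht]]] : exists x' y', [/\ `|x'| < d, `|y'| < d & H t = K x' y' * w t].
      by near: t; exact: HK.
    rewrite /psi; case: eqP => [_|/eqP wt]; first by rewrite subrr normr0.
    by rewrite Ht mulfK // distrC Kd.
  apply: cvg_trans (cvgM psic dw); apply: near_eq_cvg; near=> t.
  have [x' [y' [_ _ Ht]]] : exists x' y', [/\ `|x'| < 1, `|y'| < 1 & H t = K x' y' * w t].
    by near: t; exact: HK.
  rewrite /= /psi w0 subr0 /GRing.scale /=; case: eqP => [wt|/eqP wt].
    by rewrite Ht wt !mulr0.
  by rewrite mulrCA mulfVK // mulrC.
have Hx := key x (fun t => G (x t) (y t) - G 0 (y t)) a Gx x0 dx cGx.
have Hy := key y (fun t => G 0 (y t) - G 0 0) b (fun _ => Gy 0) y0 dy.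
apply/is_derive0P; rewrite x0 y0.
have {}Hx : t^-1 *: (G (x t) (y t) - G 0 (y t)) @[t --> 0^'] --> Gx 0 0 * a.
  apply: Hx => d d0.
  near=> t.
  have xe : `|x t| < e by near: t; exact: small.
  have ye : `|y t| < e by near: t; exact: small.
  have xd : `|x t| < d by near: t; exact: small.
  have yd : `|y t| < d by near: t; exact: small.
  have [|c ct E] := @MVT_origin R (G^~ (y t)) (Gx^~ (y t)) (x t).
    by move=> u ut; apply: HGx => //; exact: le_lt_trans xe.
  by exists c, (y t); split => //; exact: le_lt_trans xd.
have {}Hy : t^-1 *: (G 0 (y t) - G 0 0) @[t --> 0^'] --> Gy 0 0 * b.
  apply: Hy.
    by move=> r /cGy[d d0 Hd]; exists d => // u v _ vd; apply: Hd; rewrite ?normr0.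
  move=> d d0; near=> t.
  have ye : `|y t| < e by near: t; exact: small.
  have yd : `|y t| < d by near: t; exact: small.
  have [|c ct E] := @MVT_origin R (G 0) (Gy 0) (y t).
    by move=> u ut; apply: HGy => //; [rewrite normr0|exact: le_lt_trans ye].
  by exists 0, c; split => //; [rewrite normr0|exact: le_lt_trans yd].
apply: cvg_trans (cvgD Hx Hy); apply: near_eq_cvg; near=> t.
rewrite [LHS]/= -[LHS]scalerDr; congr (_ *: _); ring.
Unshelve. all: by end_near. Qed.

(** * Charts and real coordinates *)

Lemma norm_complex_lt (R : realType) (x y e : R) :
  `|x| < e / 2 -> `|y| < e / 2 -> `|(x +i* y)%C| < (e +i* 0)%C.
Proof.
move=> xe ye; rewrite normc_def ltcE /= eqxx /=.
have e0 : 0 < e / 2 by apply: le_lt_trans xe.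
rewrite -[ltRHS]ger0_norm; last by lra.
rewrite -sqrtr_sqr ltr_sqrt; last by rewrite exprn_gt0 //; lra.
have : `|x| ^+ 2 < (e / 2) ^+ 2 by rewrite ltr_pXn2r // nnegrE //; lra.
have : `|y| ^+ 2 < (e / 2) ^+ 2 by rewrite ltr_pXn2r // nnegrE //; lra.
rewrite !real_normK ?num_real //.
have : 0 < (e / 2) ^+ 2 by rewrite exprn_gt0.
nra.
Qed.

Lemma complex_lt_norm (R : realType) (z : R[i]%C) (e : R) :
  `|z| < (e +i* 0)%C -> `|complex.Re z| < e /\ `|complex.Im z| < e.
Proof.
case: z => x y; rewrite normc_def ltcE /= eqxx /= => H.
have xx : 0 <= x ^+ 2 by exact: sqr_ge0.
have yy : 0 <= y ^+ 2 by exact: sqr_ge0.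
by split; apply: le_lt_trans H; rewrite -sqrtr_sqr ler_sqrt; lra.
Qed.

(** Balls of [R[i]^o] have radii in R[i], and positivity forces a radius to be real; discs and
    squares are nested up to a factor 2. *)
Lemma nbhs_complexP (R : realType) (c : Cplx R) (A : set (Cplx R)) :
  nbhs c A <-> exists2 e : R, 0 < e &
    forall x y, `|x| < e -> `|y| < e -> A (c + (x +i* y)%C).
Proof.
split=> [/nbhs_ballP[[e e'] /= e0 eA]|[e e0 eA]].
  move: e0; rewrite ltcE /= => /andP[/eqP e'0 e0].
  exists (e / 2); first by rewrite divr_gt0.
  move=> x y xe ye; apply: eA; rewrite -ball_normE /= opprD addrA subrr add0r normrN.
  by rewrite e'0; exact: norm_complex_lt.
apply/nbhs_ballP; exists (e +i* 0)%C; first by rewrite /= ltcE /= eqxx.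
move=> [a b]; rewrite -ball_normE /=; case: c eA => c1 c2 eA.
rewrite distrC => /complex_lt_norm[/= ae be].
have := eA _ _ ae be; congr A.
by rewrite /=; congr (_ +i* _)%C; ring.
Qed.

Lemma complex_cvgP (R : realType) (F : set_system R) {FF : Filter F}
    (f : R -> Cplx R) (c : Cplx R) :
  f @ F --> c <-> (fun t => complex.Re (f t)) @ F --> complex.Re c /\
                 (fun t => complex.Im (f t)) @ F --> complex.Im c.
Proof.
split=> [fc|[rc ic]].
  split; apply/cvgrPdist_lt => e e0.
    have /fc : nbhs c [set c' : Cplx R | `|complex.Re c - complex.Re c'| < e].
      apply/nbhs_complexP; exists e => // x y xe ye.
      by case: (c) => a b /=; rewrite opprD addrA subrr add0r normrN.
    by [].
  have /fc : nbhs c [set c' : Cplx R | `|complex.Im c - complex.Im c'| < e].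
    apply/nbhs_complexP; exists e => // x y xe ye.
    by case: (c) => a b /=; rewrite opprD addrA subrr add0r normrN.
  by [].
move=> A /nbhs_complexP[e e0 eA].
move/cvgrPdist_lt/(_ _ e0) : rc => rc; move/cvgrPdist_lt/(_ _ e0) : ic => ic.
apply: filterS2 rc ic => t /= rt it.
rewrite distrC in rt; rewrite distrC in it.
have := eA _ _ rt it; congr A.
by move: (f t); case: (c) => a b [a' b'] /=; congr (_ +i* _)%C; ring.
Qed.

Section Charts.
Variables (R : realType) (M : riemannSurface R).
Implicit Types (z : lchart R M) (U : set M) (p q : M).

Definition plane z p (x y : R) : M := bwd z (fwd z p + (x +i* y)%C).

(** Since [bwd] is arbitrary off the image of the chart, the coordinates of [plane z p x y] are the
    expected ones only on a small square around [p]. *)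
Lemma plane_near z U p : is_lchart z -> open U -> U `<=` dom z -> U p ->
  exists2 e : R, 0 < e & forall x y, `|x| < e -> `|y| < e ->
    U (plane z p x y) /\ fwd z (plane z p x y) = fwd z p + (x +i* y)%C.
Proof.
move=> [_ cod_z zK _ cont_bwd] oU Uz Up.
have cp : (fwd z @` dom z) (fwd z p) by exists p => //; exact: Uz.
have : nbhs (fwd z p) [set c | U (bwd z c) /\ (fwd z @` dom z) c].
  apply: filterI; last exact: open_nbhs_nbhs.
  by apply: (cont_bwd _ cp); apply: open_nbhs_nbhs; rewrite zK; [split|exact: Uz].
move=> /nbhs_complexP[e e0 H]; exists e => // x y xe ye.
have [Uq [q zq E]] := H _ _ xe ye.
by split => //; rewrite /plane -E zK.
Qed.

Lemma plane0 z p : is_lchart z -> dom z p -> plane z p 0 0 = p.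
Proof. by move=> cz zp; rewrite /plane addr0 (fwdK cz). Qed.

Lemma plane_shift z p q x y : fwd z q = fwd z p + (x +i* y)%C ->
  forall s t, plane z q s t = plane z p (x + s) (y + t).
Proof. by move=> E s t; rewrite /plane E -addrA. Qed.

End Charts.

(** * Partial derivatives in a chart *)

(** The boolean is the direction, [false] for u and [true] for v; [~~ b] is the other direction, so
    arguments that exchange u and v are written once. *)
Definition line (R : realType) (M : riemannSurface R) (z : lchart R M) (b : bool)
  (p : M) (t : R) : M := if b then plane z p 0 t else plane z p t 0.

(* Locked because unification would otherwise unfold derivatives when comparing
   distinct vectors. *)
HB.lock Definition D (R : realType) (M : riemannSurface R) (V : normedModType R)
    (z : lchart R M) (b : bool) (f : M -> V) (p : M) : V :=
  derive1 (fun t => f (line z b p t)) 0.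
Canonical D_unlockable := Unlockable D.unlock.

Section Derivations.
Variables (R : realType) (M : riemannSurface R).
Implicit Types (z : lchart R M) (U : set M) (p q : M) (b : bool) (V : normedModType R).

Definition isD V z b (f : M -> V) p (d : V) :=
  is_derive (0 : R) (1 : R) (fun t => f (line z b p t)) d.

Lemma D_false z f : Du z f = D z false f.
Proof. by apply/funext => p; rewrite unlock. Qed.

Lemma D_true z f : Dv z f = D z true f.
Proof. by apply/funext => p; rewrite unlock. Qed.

Lemma isD_val V z b (f : M -> V) p d : isD z b f p d -> D z b f p = d.
Proof. by move=> H; rewrite unlock derive1E; exact: derive_val. Qed.

Lemma isD_D V z b (f : M -> V) p :
  derivable (fun t => f (line z b p t)) 0 1 -> isD z b f p (D z b f p).
Proof. by move=> H; rewrite unlock derive1E; exact: derivableP. Qed.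

Lemma isD_eq V z b (f : M -> V) p d d' : isD z b f p d -> d = d' -> isD z b f p d'.
Proof. by move=> H <-. Qed.

Lemma line_near z U p b : is_lchart z -> open U -> U `<=` dom z -> U p ->
  \forall t \near (0 : R), U (line z b p t).
Proof.
move=> cz oU Uz Up; have [e e0 He] := plane_near cz oU Uz Up.
exists e => //= t; rewrite /ball_/= sub0r normrN => te.
rewrite /line; have z0 : `|0 : R| < e by rewrite normr0.
by case: b; have [] := He _ _ z0 te; have [] := He _ _ te z0.
Qed.

Lemma line0 z b p : is_lchart z -> dom z p -> line z b p 0 = p.
Proof. by move=> cz zp; rewrite /line; case: b; exact: plane0. Qed.

Lemma near_line_eq V z U p b (f g : M -> V) :
  is_lchart z -> open U -> U `<=` dom z -> U p ->
  (forall q, U q -> f q = g q) ->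
  \forall t \near (0 : R), f (line z b p t) = g (line z b p t).
Proof.
move=> cz oU Uz Up fg; have := line_near b cz oU Uz Up.
by apply: filterS => t Ut; exact: fg.
Qed.

Lemma isD_local V z U p b (f g : M -> V) d :
  is_lchart z -> open U -> U `<=` dom z -> U p ->
  (forall q, U q -> f q = g q) -> isD z b f p d -> isD z b g p d.
Proof. by move=> cz oU Uz Up fg; apply: near_eq_is_derive; exact: (near_line_eq b cz oU Uz Up fg). Qed.

Lemma D_local V z U p b (f g : M -> V) :
  is_lchart z -> open U -> U `<=` dom z -> U p ->
  (forall q, U q -> f q = g q) -> D z b f p = D z b g p.
Proof.
move=> cz oU Uz Up fg; rewrite unlock !derive1E; apply: near_eq_derive.
exact: (near_line_eq b cz oU Uz Up fg).
Qed.

Lemma isD_cst V z b p (a : V) : isD z b (fun _ => a) p 0.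
Proof. exact: is_derive_cst. Qed.

Lemma isD_add V z b p (f g : M -> V) df dg :
  isD z b f p df -> isD z b g p dg -> isD z b (fun q => f q + g q) p (df + dg).
Proof. by move=> Hf Hg; apply: is_deriveD. Qed.

Lemma isD_mul z b p (f g : M -> R) df dg : is_lchart z -> dom z p ->
  isD z b f p df -> isD z b g p dg ->
  isD z b (fun q => f q * g q) p (df * g p + f p * dg).
Proof.
move=> cz zp Hf Hg.
apply: (@is_derive_eq _ _ _ _ _ _ _ _ (is_deriveM Hf Hg)).
by rewrite line0 // /GRing.scale /= addrC mulrC.
Qed.

Lemma isD_inv z b p (f : M -> R) df : is_lchart z -> dom z p ->
  f p != 0 -> isD z b f p df ->
  isD z b (fun q => (f q)^-1) p (- ((f p)^-1 * (f p)^-1 * df)).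
Proof.
move=> cz zp fp Hf.
have fp' : f (line z b p 0) != 0 by rewrite line0.
apply: (@is_derive_eq _ _ _ _ _ _ _ _ (is_deriveV fp' Hf)).
by rewrite line0 // /GRing.scale /= expr2 invfM mulNr.
Qed.

Lemma isD_row z b p (F : M -> 'rV[R]_6) (d : 'rV[R]_6) :
  isD z b F p d <-> forall j, isD z b (fun q => F q 0 j) p (d 0 j).
Proof.
split=> [[H E] j|H].
  have /derivable_mxP/(_ 0 j) Hj := H.
  by apply: DeriveDef => //; rewrite -E derive_mx // mxE.
have dF : derivable (fun t => F (line z b p t)) (0 : R) 1.
  by apply/derivable_mxP => i j; rewrite ord1; have [] := H j.
apply: DeriveDef => //; rewrite derive_mx //; apply/rowP => j.
by rewrite mxE; have [] := H j.
Qed.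

Lemma isD_sum z b p (I : Type) (r : seq I) (f : I -> M -> R) (d : I -> R) :
  (forall i, isD z b (f i) p (d i)) ->
  isD z b (fun q => \sum_(i <- r) f i q) p (\sum_(i <- r) d i).
Proof.
move=> H; elim: r => [|i r IH].
  by rewrite big_nil; under [X in isD _ _ X]funext do rewrite big_nil; exact: isD_cst.
by rewrite big_cons; under [X in isD _ _ X]funext do rewrite big_cons; exact: isD_add.
Qed.

Lemma isD_form z b p (F G : M -> 'rV[R]_6) dF dG : is_lchart z -> dom z p ->
  isD z b F p dF -> isD z b G p dG ->
  isD z b (fun q => form (F q) (G q)) p (form dF (G p) + form (F p) dG).
Proof.
move=> cz zp /isD_row HF /isD_row HG; rewrite /form -big_split /=.
apply: isD_sum => j.
apply: (isD_eq (isD_mul cz zp (isD_cst _ _ _ _) (isD_mul cz zp (HF j) (HG j)))).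
by rewrite mul0r add0r mulrDr.
Qed.

Lemma isD_scale z b p (g : M -> R) (F : M -> 'rV[R]_6) dg dF : is_lchart z -> dom z p ->
  isD z b g p dg -> isD z b F p dF ->
  isD z b (fun q => g q *: F q) p (dg *: F p + g p *: dF).
Proof.
move=> cz zp Hg /isD_row HF; apply/isD_row => j.
under [X in isD _ _ X]funext do rewrite mxE.
by rewrite !mxE; exact: isD_mul.
Qed.

End Derivations.

(** * Smooth functions in a chart *)

Lemma is_derive_shift0 (R : realType) (g : R -> R) (x d : R) :
  is_derive (0 : R) (1 : R) (fun t => g (x + t)) d -> is_derive x (1 : R) g d.
Proof.
move=> /is_derive0P H.
have H' : (fun h : R => h^-1 *: (g (h *: (1 : R) + x) - g x)) @ 0^' --> d.
  suff -> : (fun h : R => h^-1 *: (g (h *: (1 : R) + x) - g x)) =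
            fun h : R => h^-1 *: (g (x + h) - g (x + 0)) by [].
  by apply/funext => h; rewrite addr0 [_ *: _ + x]addrC /GRing.scale /= mulr1.
by apply: DeriveDef; [apply/cvg_ex; exists d|exact/cvg_lim].
Qed.

Section Smooth.
Variables (R : realType) (M : riemannSurface R).
Implicit Types (z : lchart R M) (U W : set M) (p q : M) (b : bool) (V : normedModType R).

Lemma plane_nbhs z p (A : set M) : is_lchart z -> dom z p -> nbhs p A ->
  exists2 e : R, 0 < e & forall x y, `|x| < e -> `|y| < e -> A (plane z p x y).
Proof.
move=> cz zp pA.
have cp : (fwd z @` dom z) (fwd z p) by exists p.
have /nbhs_complexP[e e0 H] : nbhs (fwd z p) [set c | A (bwd z c)].
  by apply: (bwd_continuous cz cp); rewrite (fwdK cz).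
by exists e.
Qed.

Lemma continuous_plane z p (f : M -> R) : is_lchart z -> dom z p ->
  {for p, continuous f} -> cont_origin (fun x y => f (plane z p x y)).
Proof.
move=> cz zp fc e e0.
have : nbhs p [set q | `|f p - f q| < e].
  by move: fc => /cvgrPdist_lt/(_ _ e0).
move=> /(plane_nbhs cz zp)[d d0 Hd]; exists d => // x y xd yd.
by rewrite plane0 // distrC; exact: Hd.
Qed.

(** Turns derivatives at a moving point of the chart into partial derivatives of one function on a
    fixed square, as required by [Schwarz_plane] and [chain_plane]. *)
Lemma isD_plane z b p (x y : R) (f : M -> R) d :
  fwd z (plane z p x y) = fwd z p + (x +i* y)%C ->
  isD z b f (plane z p x y) d ->
  if b then is_derive y (1 : R) (fun t => f (plane z p x t)) d
  else is_derive x (1 : R) (fun t => f (plane z p t y)) d.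
Proof.
move=> E; rewrite /isD /line; case: b => H; apply: is_derive_shift0; move: H.
  by under eq_fun do rewrite (plane_shift E) addr0.
by under eq_fun do rewrite (plane_shift E) addr0.
Qed.

(** Unlike [Ck], this asks for continuity at every order and not only at the last, so that the
    classes decrease with [k] by a plain induction. For all orders together the two notions
    agree. *)
Fixpoint Cr V z U k (f : M -> V) : Prop :=
  (forall p, U p -> {for p, continuous f}) /\
  if k is k'.+1 then
    (forall b p, U p -> derivable (fun t => f (line z b p t)) 0 1) /\
    forall b, Cr z U k' (D z b f)
  else True.

Lemma Cr_cont V z U k (f : M -> V) p : Cr z U k f -> U p -> {for p, continuous f}.
Proof. by case: k => [|k] [H _]; exact: H. Qed.

Lemma Cr_isD V z U k (f : M -> V) b p : Cr z U k.+1 f -> U p -> isD z b f p (D z b f p).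
Proof. by case=> _ [H _] Up; apply: isD_D; exact: H. Qed.

Lemma Cr_D V z U k (f : M -> V) b : Cr z U k.+1 f -> Cr z U k (D z b f).
Proof. by case=> _ [_]; exact. Qed.

Lemma Cr_S V z U k (f : M -> V) : Cr z U k.+1 f -> Cr z U k f.
Proof.
elim: k f => [|k IH] f [fc [fd fD]]; first by split.
by split => //; split => // b; exact: IH.
Qed.

Lemma Cr_sub V z U W k (f : M -> V) : W `<=` U -> Cr z U k f -> Cr z W k f.
Proof.
move=> WU; elim: k f => [|k IH] f [fc H]; first by split=> // p /WU; exact: fc.
by split=> [p /WU/fc|] //; split=> [b p /WU|b]; [exact: H.1|exact: IH (H.2 b)].
Qed.

(** Every clause of [Cr] is a condition at one point, and [D] does not depend on the set. *)
Lemma Cr_local V z U k (f : M -> V) :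
  (forall p, U p -> exists2 W, W p & Cr z W k f) -> Cr z U k f.
Proof.
elim: k f => [|k IH] f H.
  by split=> // p /H[W Wp HW]; exact: Cr_cont HW Wp.
split=> [p /H[W Wp HW]|]; first exact: Cr_cont HW Wp.
split=> [b p /H[W Wp [_ [fd _]]]|b]; first exact: fd.
by apply: IH => p /H[W Wp [_ [_ fD]]]; exists W => //; exact: fD.
Qed.

Section Closure.
Variables (z : lchart R M) (U : set M).
Hypothesis cz : is_lchart z.
Hypothesis oU : open U.
Hypothesis Uz : U `<=` dom z.

Lemma Cr_eq V k (f g : M -> V) : (forall q, U q -> f q = g q) -> Cr z U k f -> Cr z U k g.
Proof.
have gc f' g' : (forall q, U q -> f' q = g' q) -> (forall p, U p -> {for p, continuous f'}) ->
    forall p, U p -> {for p, continuous g'}.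
  move=> fg fc p Up; have H : g' @ p --> f' p.
    apply: cvg_trans (fc p Up); apply: near_eq_cvg.
    by apply: filterS (open_nbhs_nbhs (conj oU Up)) => q Uq /=; rewrite fg.
  by rewrite fg in H.
elim: k f g => [|k IH] f g fg [fc H]; split=> //; try exact: gc fc.
split=> [b p Up|b].
  have := isD_local cz oU Uz Up fg (isD_D (H.1 b p Up)).
  by case.
by apply: IH (H.2 b) => q Uq; exact: D_local fg.
Qed.

(** The scheme of the closure proofs below: it suffices to give the derivatives by formulas valid on
    [U] whose terms are covered by the induction hypothesis. *)
Lemma Cr_step V k (f : M -> V) (df : bool -> M -> V) :
  (forall p, U p -> {for p, continuous f}) ->
  (forall b p, U p -> isD z b f p (df b p)) ->
  (forall b, Cr z U k (df b)) -> Cr z U k.+1 f.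
Proof.
move=> fc fd fD; split=> //; split=> [b p Up|b]; first by have [] := fd b p Up.
by apply: Cr_eq (fD b) => q Uq; rewrite (isD_val (fd b q Uq)).
Qed.

Lemma Cr_cst V k (a : V) : Cr z U k (fun _ => a).
Proof.
elim: k a => [|k IH] a; first by split=> // p _; exact: cvg_cst.
by apply: (Cr_step (df := fun _ _ => 0)) => // [p _|b p _]; [exact: cvg_cst|exact: isD_cst].
Qed.

Lemma Cr_add V k (f g : M -> V) : Cr z U k f -> Cr z U k g -> Cr z U k (fun q => f q + g q).
Proof.
elim: k f g => [|k IH] f g Hf Hg.
  by split=> // p Up; apply: cvgD; [exact: Cr_cont Hf Up|exact: Cr_cont Hg Up].
apply: (Cr_step (df := fun b q => D z b f q + D z b g q)) => [p Up|b p Up|b].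
- by apply: cvgD; [exact: Cr_cont Hf Up|exact: Cr_cont Hg Up].
- by apply: isD_add; [exact: Cr_isD Hf Up|exact: Cr_isD Hg Up].
- by apply: IH; exact: Cr_D.
Qed.

Lemma Cr_mul k (f g : M -> R) : Cr z U k f -> Cr z U k g -> Cr z U k (fun q => f q * g q).
Proof.
elim: k f g => [|k IH] f g Hf Hg.
  by split=> // p Up; apply: cvgM; [exact: Cr_cont Hf Up|exact: Cr_cont Hg Up].
apply: (Cr_step (df := fun b q => D z b f q * g q + f q * D z b g q)) => [p Up|b p Up|b].
- by apply: cvgM; [exact: Cr_cont Hf Up|exact: Cr_cont Hg Up].
- exact: isD_mul cz (Uz Up) (Cr_isD b Hf Up) (Cr_isD b Hg Up).
- by apply: Cr_add; apply: IH; [exact: Cr_D|exact: Cr_S|exact: Cr_S|exact: Cr_D].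
Qed.

Lemma Cr_inv k (f : M -> R) : (forall q, U q -> f q != 0) ->
  Cr z U k f -> Cr z U k (fun q => (f q)^-1).
Proof.
move=> f0; elim: k => [|k IH] Hf.
  by split=> // p Up; apply: cvgV; [exact: f0|exact: Cr_cont Hf Up].
apply: (Cr_step (df := fun b q => -1 * ((f q)^-1 * (f q)^-1 * D z b f q))) => [p Up|b p Up|b].
- by apply: cvgV; [exact: f0|exact: Cr_cont Hf Up].
- by rewrite mulN1r; exact: isD_inv cz (Uz Up) (f0 _ Up) (Cr_isD b Hf Up).
- have Hi := IH (Cr_S Hf).
  by do 2?[apply: Cr_mul; first by [exact: Cr_cst|exact: Cr_mul]]; exact: Cr_D.
Qed.

Lemma Cr_sqrt k (f : M -> R) : (forall q, U q -> 0 < f q) ->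
  Cr z U k f -> Cr z U k (fun q => Num.sqrt (f q)).
Proof.
move=> f0; elim: k => [|k IH] Hf.
  split=> // p Up; apply: (@continuous_comp _ _ _ f Num.sqrt); first exact: Cr_cont Hf Up.
  exact: sqrt_continuous.
apply: (Cr_step (df := fun b q => (2 * Num.sqrt (f q))^-1 * D z b f q)) => [p Up|b p Up|b].
- by apply: (@continuous_comp _ _ _ f Num.sqrt); [exact: Cr_cont Hf Up|exact: sqrt_continuous].
- have Hd := Cr_isD b Hf Up.
  have fp : 0 < f (line z b p 0) by rewrite line0 //; [exact: f0|exact: Uz].
  have := is_derive1_comp (is_derive1_sqrt fp) Hd.
  by rewrite line0 //; exact: Uz.
- apply: Cr_mul; last exact: Cr_D.
  apply: Cr_inv => [q Uq|]; first by rewrite mulf_neq0 // gt_eqF // sqrtr_gt0 f0.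
  by apply: Cr_mul; [exact: Cr_cst|exact: IH (Cr_S Hf)].
Qed.

Lemma Cr_sum k (I : Type) (r : seq I) (f : I -> M -> R) :
  (forall i, Cr z U k (f i)) -> Cr z U k (fun q => \sum_(i <- r) f i q).
Proof.
move=> H; elim: r => [|i r IH].
  by under [X in Cr _ _ _ X]funext do rewrite big_nil; exact: Cr_cst.
by under [X in Cr _ _ _ X]funext do rewrite big_cons; exact: Cr_add.
Qed.

Lemma continuous_row (F : M -> 'rV[R]_6) p :
  {for p, continuous F} <-> forall j, {for p, continuous (fun q => F q 0 j)}.
Proof.
split=> [Fc j|Fc].
  by apply: (@continuous_comp _ _ _ F (fun v : 'rV[R]_6 => v 0 j)) => //; exact: coord_continuous.
move=> A [P HP PA].
have : \forall q \near p, forall j, P 0 j (F q 0 j).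
  by apply: filter_forall => j; exact: (Fc j _ (HP 0 j)).
by apply: filterS => q Hq; apply: PA => i j; rewrite ord1.
Qed.

Lemma Cr_row k (F : M -> 'rV[R]_6) : Cr z U k F <-> forall j, Cr z U k (fun q => F q 0 j).
Proof.
elim: k F => [|k IH] F.
  split=> [[Fc _] j|H]; split=> // p Up.
    by move: j; apply/continuous_row; exact: Fc.
  by apply/continuous_row => j; exact: Cr_cont (H j) Up.
split=> [HF j|H].
  apply: (Cr_step (df := fun b q => D z b F q 0 j)) => [p Up|b p Up|b].
  - by move: j; apply/continuous_row; exact: Cr_cont HF Up.
  - by move: j; apply/isD_row; exact: Cr_isD HF Up.
  - by move: j; apply/IH; exact: Cr_D.
apply: (Cr_step (df := fun b q => \row_j D z b (fun q => F q 0 j) q)) => [p Up|b p Up|b].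
- by apply/continuous_row => j; exact: Cr_cont (H j) Up.
- by apply/isD_row => j; rewrite mxE; exact: Cr_isD (H j) Up.
- by apply/IH => j; under [X in Cr _ _ _ X]funext do rewrite mxE; exact: Cr_D.
Qed.

Lemma Cr_form k (F G : M -> 'rV[R]_6) :
  Cr z U k F -> Cr z U k G -> Cr z U k (fun q => form (F q) (G q)).
Proof.
move=> /Cr_row HF /Cr_row HG; apply: Cr_sum => j.
by apply: Cr_mul; [exact: Cr_cst|exact: Cr_mul].
Qed.

Lemma Cr_scale k (g : M -> R) (F : M -> 'rV[R]_6) :
  Cr z U k g -> Cr z U k F -> Cr z U k (fun q => g q *: F q).
Proof.
move=> Hg /Cr_row HF; apply/Cr_row => j.
by under [X in Cr _ _ _ X]funext do rewrite mxE; exact: Cr_mul.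
Qed.

Lemma D_comm_scalar (f : M -> R) p : Cr z U 2 f -> U p ->
  D z true (D z false f) p = D z false (D z true f) p.
Proof.
move=> Hf Up; have [e e0 He] := plane_near cz oU Uz Up.
have zp := Uz Up.
pose P g x y : R := g (plane z p x y).
have HP g : Cr z U 1 g -> forall x y, `|x| < e -> `|y| < e ->
    is_derive x (1 : R) (fun t => P g t y) (P (D z false g) x y) /\
    is_derive y (1 : R) (fun t => P g x t) (P (D z true g) x y).
  move=> Hg x y xe ye; have [Uxy E] := He x y xe ye; split.
    exact: (isD_plane (b := false) E (Cr_isD false Hg Uxy)).
  exact: (isD_plane (b := true) E (Cr_isD true Hg Uxy)).
have H0 := HP _ (Cr_S Hf).
have Hu := HP _ (Cr_D false Hf); have Hv := HP _ (Cr_D true Hf).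
have Huv : cont_origin (P (D z true (D z false f))).
  exact: continuous_plane cz zp (Cr_cont (Cr_D true (Cr_D false Hf)) Up).
have Hvu : cont_origin (P (D z false (D z true f))).
  exact: continuous_plane cz zp (Cr_cont (Cr_D false (Cr_D true Hf)) Up).
have := Schwarz_plane e0
  (fun x y xe ye => (H0 x y xe ye).1) (fun x y xe ye => (H0 x y xe ye).2)
  (fun x y xe ye => (Hu x y xe ye).2) (fun x y xe ye => (Hv x y xe ye).1) Huv Hvu.
by rewrite /P (plane0 cz zp).
Qed.

Lemma D_row k (F : M -> 'rV[R]_6) b p j : Cr z U k.+1 F -> U p ->
  D z b F p 0 j = D z b (fun q => F q 0 j) p.
Proof.
move=> HF Up; have /isD_row/(_ j) := Cr_isD b HF Up.
by move/isD_val.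
Qed.

Lemma D_comm (F : M -> 'rV[R]_6) p : Cr z U 2 F -> U p ->
  D z true (D z false F) p = D z false (D z true F) p.
Proof.
move=> HF Up; apply/rowP => j.
have E b b' : D z b (D z b' F) p 0 j = D z b (D z b' (fun q => F q 0 j)) p.
  transitivity (D z b (fun q => D z b' F q 0 j) p).
    exact: (D_row b j (Cr_D b' HF) Up).
  by apply: (D_local b cz oU Uz Up) => q Uq; exact: (D_row b' j HF Uq).
apply: etrans (E true false) (etrans _ (esym (E false true))).
apply: D_comm_scalar Up.
by move/Cr_row: HF.
Qed.

End Closure.

Lemma smooth_on_Cr U z k (F : M -> 'rV[R]_6) : coordinate z -> smooth_on U F ->
  Cr z (U `&` dom z) k F.
Proof.
move=> cz /(_ z cz); elim: k F => [|k IH] F H; first by split => //; exact: (H 0%N).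
split; first exact: (H 0%N).
split=> [[] p Up|[]]; [exact: ((H 1%N).1 p Up).2|exact: ((H 1%N).1 p Up).1| |].
  by rewrite -D_true; apply: IH => j; have [_ []] := H j.+1.
by rewrite -D_false; apply: IH => j; have [_ []] := H j.+1.
Qed.

Lemma Cr_smooth_on U (F : M -> 'rV[R]_6) :
  (forall z k, coordinate z -> Cr z (U `&` dom z) k F) -> smooth_on U F.
Proof.
move=> H z cz k; have {}H k' := H z k' cz.
elim: k F H => [|k IH] F H; first by have [] := H 0%N.
split=> [p Up|].
  by have [_ [Hd _]] := H 1%N; split; [exact: (Hd false)|exact: (Hd true)].
by rewrite D_false D_true; split; apply: IH => j; [exact: (Cr_D false (H j.+1))|exact: (Cr_D true (H j.+1))].
Qed.

End Smooth.

(** * Change of coordinates *)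

Lemma complex_invr (R : realType) (t : R) : t != 0 -> ((t +i* 0)^-1 = t^-1 +i* 0)%C.
Proof.
by move=> t0; apply/eqP; rewrite eq_complex /= expr0n addr0 mul0r oppr0 eqxx andbT;
  apply/eqP; field.
Qed.

Lemma complex_invi (R : realType) (t : R) : t != 0 -> ((0 +i* t)^-1 = 0 +i* (- t^-1))%C.
Proof.
by move=> t0; apply/eqP; rewrite eq_complex /= expr0n add0r mul0r eqxx /=;
  apply/eqP; congr (- _); field.
Qed.

Section Transition.
Variables (R : realType) (M : riemannSurface R).
Implicit Types (z w : lchart R M) (U W : set M) (p q : M) (b : bool).

Definition transition_diff z w p b t : Cplx R := fwd w (line z b p t) - fwd w p.

(** The Cauchy-Riemann equations: if a + ic is the complex derivative of the transition, the
    derivative along u is a + ic and the one along v is i(a + ic) = -c + ia. *)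
Lemma transition_difference z w p : is_lchart z -> dom z p -> dom w p ->
  holomorphic_transition z w ->
  exists a c : R, forall b,
    (fun t : R => t^-1 *: complex.Re (transition_diff z w p b t)) @ 0^' --> (if b then - c else a) /\
    (fun t : R => t^-1 *: complex.Im (transition_diff z w p b t)) @ 0^' --> (if b then a else c).
Proof.
move=> cz zp wp hol.
have : derivable (fwd w \o bwd z) (fwd z p : Cplx R) 1 by apply: hol; exists p.
move=> /cvg_ex[/= T HT]; exists (complex.Re T), (complex.Im T).
have toC b : (fun t : R => (if b then (0 +i* t)%C else (t +i* 0)%C) : Cplx R) @ 0^' --> (0 : Cplx R)^'.
  move=> A /nbhs_complexP[e e0 eA]; exists e => //= t.
  rewrite /ball_/= sub0r normrN => te t0.
  have z0 : `|0 : R| < e by rewrite normr0.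
  have := eA _ _ z0 te; have := eA _ _ te z0; rewrite !add0r.
  case: b => Ar Ai; [apply: Ai|apply: Ar]; rewrite eq_complex /= eqxx /= ?andbT //.
have fz : bwd z (fwd z p) = p by rewrite (fwdK cz).
have {}HT : (fun h : Cplx R => h^-1 * (fwd w (bwd z (fwd z p + h)) - fwd w p) : Cplx R) @ 0^' --> T.
  suff <- : (fun h : Cplx R => h^-1 *: (fwd w (bwd z (h *: (1 : Cplx R) + fwd z p)) -
     fwd w (bwd z (fwd z p)))) =
    (fun h : Cplx R => h^-1 * (fwd w (bwd z (fwd z p + h)) - fwd w p) : Cplx R) by [].
  by apply/funext => h; rewrite fz [_ *: _ + fwd z p]addrC /GRing.scale /= mulr1.
move=> b; pose d := transition_diff z w p b; rewrite -/d.
have /complex_cvgP[] := cvg_comp _ _ (toC b) HT.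
have dE t : fwd w (bwd z (fwd z p + (if b then 0 +i* t else t +i* 0)%C)) - fwd w p = d t.
  by rewrite /d /transition_diff /line /plane; case: (b).
have nz : \forall t \near (0 : R)^', t != 0 by exact: nbhs_dnbhs_neq.
(* For h = it one has 1/h = -i/t, so the real and imaginary parts of the quotient change places, one
   of them with a sign. *)
case: b d dE => d dE HR HI; split.
- move/cvgN: HI => HI; apply: cvg_trans HI; apply: near_eq_cvg.
  apply: filterS nz => t t0.
  transitivity (- complex.Im ((0 +i* t)%C^-1 * (d t : R[i]%C))); first by rewrite -dE.
  rewrite complex_invi //; case: (d t) => x y.
  by rewrite /GRing.scale /=; ring.
- apply: cvg_trans HR; apply: near_eq_cvg.
  apply: filterS nz => t t0.
  rewrite /= dE complex_invi //; case: (d t) => x y.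
  by rewrite /GRing.scale /=; ring.
- apply: cvg_trans HR; apply: near_eq_cvg.
  apply: filterS nz => t t0.
  rewrite /= dE complex_invr //; case: (d t) => x y.
  by rewrite /GRing.scale /=; ring.
- apply: cvg_trans HI; apply: near_eq_cvg.
  apply: filterS nz => t t0.
  rewrite /= dE complex_invr //; case: (d t) => x y.
  by rewrite /GRing.scale /=; ring.
Qed.

(** The coefficients are chosen before [f]: the lifts Y and L must later be transformed by the same
    [a] and [c]. *)
Lemma chain_rule z w p : is_lchart z -> is_lchart w -> dom z p -> dom w p ->
  holomorphic_transition z w ->
  exists a c : R, forall U (f : M -> R), open U -> U `<=` dom w -> U p -> Cr w U 1 f ->
    isD z false f p (a * D w false f p + c * D w true f p) /\
    isD z true f p (- c * D w false f p + a * D w true f p).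
Proof.
move=> cz cw zp wp hol; have [a [c H]] := transition_difference cz zp wp hol.
exists a, c => U f oU Uw Up Hf.
pose d b := transition_diff z w p b.
have d0 b : d b 0 = 0 by rewrite /d /transition_diff line0 // subrr.
have dRe b : is_derive (0 : R) (1 : R) (fun t => complex.Re (d b t)) (if b then - c else a).
  by apply/is_derive0P; rewrite d0 /=; under eq_fun do rewrite subr0; exact: (H b).1.
have dIm b : is_derive (0 : R) (1 : R) (fun t => complex.Im (d b t)) (if b then a else c).
  by apply/is_derive0P; rewrite d0 /=; under eq_fun do rewrite subr0; exact: (H b).2.
have [e e0 He] := plane_near cw oU Uw Up.
pose P g x y : R := g (plane w p x y).
have key b : isD z b f p (D w false f p * (if b then - c else a) + D w true f p * (if b then a else c)).
  have cD b' : cont_origin (P (D w b' f)).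
    exact: continuous_plane cw wp (Cr_cont (Cr_D b' Hf) Up).
  have Hx x y : `|x| < e -> `|y| < e -> is_derive x (1 : R) (fun t => P f t y) (P (D w false f) x y).
    move=> xe ye; have [Uxy E] := He x y xe ye.
    exact: (isD_plane (b := false) E (Cr_isD false Hf Uxy)).
  have Hy x y : `|x| < e -> `|y| < e -> is_derive y (1 : R) (fun t => P f x t) (P (D w true f) x y).
    move=> xe ye; have [Uxy E] := He x y xe ye.
    exact: (isD_plane (b := true) E (Cr_isD true Hf Uxy)).
  have dR0 : complex.Re (d b 0) = 0 by rewrite d0.
  have dI0 : complex.Im (d b 0) = 0 by rewrite d0.
  have := chain_plane e0 Hx Hy (cD false) (cD true) dR0 dI0 (dRe b) (dIm b).
  rewrite /P (plane0 cw wp); apply: near_eq_is_derive.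
  (* For small t the line of [z] stays in [dom w], where [bwd w] recovers it from its
     [w]-coordinates. *)
  have oz : open (dom z `&` dom w) by apply: openI; exact: dom_open.
  have := line_near b cz oz (@subIsetl _ _ _) (conj zp wp).
  apply: filterS => t [_ wt]; congr f.
  rewrite /plane -[X in bwd w X](_ : fwd w (line z b p t) = _); first by rewrite (fwdK cw).
  by rewrite /d /transition_diff; case: (fwd w (line z b p t)) => x y; case: (fwd w p) => x' y' /=;
    congr (_ +i* _)%C; ring.
split; [apply: isD_eq (key false) _|apply: isD_eq (key true) _] => /=; ring.
Qed.

End Transition.

(** * The bilinear form and its complexification *)

Section Form.
Variable K : comNzRingType.
Implicit Types x y w : 'rV[K]_6.

Lemma formC x y : form x y = form y x.
Proof. by apply: eq_bigr => j _; rewrite [x 0 j * _]mulrC. Qed.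

Lemma formDl x y w : form (x + y) w = form x w + form y w.
Proof. by rewrite /form -big_split; apply: eq_bigr => j _; rewrite mxE mulrDl mulrDr. Qed.

Lemma formZl a x y : form (a *: x) y = a * form x y.
Proof. by rewrite /form mulr_sumr; apply: eq_bigr => j _; rewrite mxE; ring. Qed.

Lemma formDr x y w : form w (x + y) = form w x + form w y.
Proof. by rewrite formC formDl ![form _ w]formC. Qed.

Lemma formZr a x y : form x (a *: y) = a * form x y.
Proof. by rewrite formC formZl formC. Qed.

Lemma form0l x : form 0 x = 0.
Proof. by rewrite -(scale0r 0) formZl mul0r. Qed.

Lemma form0r x : form x 0 = 0.
Proof. by rewrite formC form0l. Qed.

Lemma formNl x y : form (- x) y = - form x y.
Proof. by rewrite -scaleN1r formZl mulN1r. Qed.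

Lemma formNr x y : form x (- y) = - form x y.
Proof. by rewrite formC formNl formC. Qed.

Definition formE := (formDl, formDr, formZl, formZr, form0l, form0r, formNl, formNr).
End Form.

Section Complexification.
Variable R : realType.
Implicit Types a b c d : 'rV[R]_6.

Lemma sum_complex (I : Type) (r : seq I) (f g : I -> R) :
  \sum_(i <- r) (f i +i* g i)%C = ((\sum_(i <- r) f i) +i* (\sum_(i <- r) g i))%C.
Proof. by elim: r => [|i r IH]; rewrite ?big_nil // !big_cons IH. Qed.

Lemma form_cvec a b c d :
  form (cvec a b) (cvec c d) = ((form a c - form b d) +i* (form a d + form b c))%C.
Proof.
have sgnE (e : bool) : (-1) ^+ e = (((-1) ^+ e : R) +i* 0)%C.
  by case: e => //=; rewrite expr1; apply/eqP; rewrite eq_complex /= oppr0 !eqxx.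
rewrite /form -sumrB -big_split /=.
rewrite (eq_bigr (fun j : 'I_6 => (((-1) ^+ (4 <= j)%N * (a 0 j * c 0 j) - (-1) ^+ (4 <= j)%N * (b 0 j * d 0 j)) +i*
  ((-1) ^+ (4 <= j)%N * (a 0 j * d 0 j) + (-1) ^+ (4 <= j)%N * (b 0 j * c 0 j)))%C)).
  exact: sum_complex.
move=> j _; rewrite !mxE sgnE; apply/eqP; rewrite eq_complex /=; apply/andP; split; apply/eqP; ring.
Qed.

Lemma rvec_cvec a b : rvec (cvec a b) = a.
Proof. by apply/rowP => j; rewrite !mxE. Qed.

Lemma ivec_cvec a b : ivec (cvec a b) = b.
Proof. by apply/rowP => j; rewrite !mxE. Qed.

Lemma cvec_add a b c d : cvec a b + cvec c d = cvec (a + c) (b + d).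
Proof. by apply/rowP => j; rewrite !mxE. Qed.

Lemma cvec_opp a b : - cvec a b = cvec (- a) (- b).
Proof. by apply/rowP => j; rewrite !mxE. Qed.

Lemma scale_cvec (s : R[i]%C) a b :
  s *: cvec a b = cvec (complex.Re s *: a - complex.Im s *: b) (complex.Re s *: b + complex.Im s *: a).
Proof. by apply/rowP => j; rewrite !mxE; case: s. Qed.

Lemma half_complex : (2^-1 : R[i]%C) = (2^-1 +i* 0)%C.
Proof.
have -> : (2 : R[i]%C) = (2 +i* 0)%C by apply/eqP; rewrite eq_complex /= addr0 !eqxx.
by rewrite complex_invr // pnatr_eq0.
Qed.

End Complexification.

(** * Wirtinger derivatives in real terms *)

Section Wirtinger.
Variables (R : realType) (M : riemannSurface R).
Implicit Types (z w : lchart R M) (Y : M -> 'rV[R]_6) (p : M).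

Lemma Dz_cvec z (A B : M -> 'rV[R]_6) p :
  Dz z (fun q => cvec (A q) (B q)) p =
  cvec (2^-1 *: (D z false A p + D z true B p)) (2^-1 *: (D z false B p - D z true A p)).
Proof.
rewrite /Dz /cDu /cDv !D_false !D_true.
have -> : @rvec R \o (fun q => cvec (A q) (B q)) = A by apply/funext => q /=; rewrite rvec_cvec.
have -> : @ivec R \o (fun q => cvec (A q) (B q)) = B by apply/funext => q /=; rewrite ivec_cvec.
rewrite !scale_cvec cvec_opp cvec_add half_complex scale_cvec /=.
by rewrite !scale0r !scale1r sub0r opprK addr0 add0r subr0.
Qed.

Lemma Dzbar_cvec z (A B : M -> 'rV[R]_6) p :
  Dzbar z (fun q => cvec (A q) (B q)) p =
  cvec (2^-1 *: (D z false A p - D z true B p)) (2^-1 *: (D z false B p + D z true A p)).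
Proof.
rewrite /Dzbar /cDu /cDv !D_false !D_true.
have -> : @rvec R \o (fun q => cvec (A q) (B q)) = A by apply/funext => q /=; rewrite rvec_cvec.
have -> : @ivec R \o (fun q => cvec (A q) (B q)) = B by apply/funext => q /=; rewrite ivec_cvec.
rewrite !scale_cvec cvec_add half_complex scale_cvec /=.
by rewrite !scale0r !scale1r sub0r addr0 add0r subr0.
Qed.

Lemma D_cst z b p (a : 'rV[R]_6) : D z b (fun _ => a) p = 0.
Proof. by apply: isD_val; exact: isD_cst. Qed.

Lemma Dz_cpx z Y p :
  Dz z (@cpx R \o Y) p = cvec (2^-1 *: D z false Y p) (- (2^-1 *: D z true Y p)).
Proof. by rewrite [LHS]Dz_cvec !D_cst addr0 sub0r scalerN. Qed.

Lemma Dzbar_cpx z Y p :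
  Dzbar z (@cpx R \o Y) p = cvec (2^-1 *: D z false Y p) (2^-1 *: D z true Y p).
Proof. by rewrite [LHS]Dzbar_cvec !D_cst subr0 add0r. Qed.

End Wirtinger.

(** * Lifts of conformal surfaces *)

Section Coordinates.
Variables (R : realType) (M : riemannSurface R).
Implicit Types (z w : lchart R M) (U W : set M) (p q : M) (b : bool) (y : M -> quadric R).
Implicit Types Y F : M -> 'rV[R]_6.

Lemma lincombE (a c : R) (x y : 'rV[R]_6) j : (a *: x + c *: y) 0 j = a * x 0 j + c * y 0 j.
Proof. by rewrite !mxE. Qed.

(** Multiplication of the complex numbers a + ic and a' + ic', written for the matrices with rows
    (a, c) and (-c, a). *)
Lemma lincomb_comp (a c a' c' : R) (x y : 'rV[R]_6) :
  let X := a' *: x + c' *: y in let Y := - c' *: x + a' *: y in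
  a *: X + c *: Y = (a * a' - c * c') *: x + (a * c' + c * a') *: y /\
  - c *: X + a *: Y = - (a * c' + c * a') *: x + (a * a' - c * c') *: y.
Proof. by split; apply/rowP => j; rewrite !mxE; ring. Qed.

Lemma form_lincomb (a c : R) (x y w : 'rV[R]_6) :
  form (a *: x + c *: y) w = a * form x w + c * form y w.
Proof. by rewrite formDl !formZl. Qed.

Lemma form_wirtinger (x y : 'rV[R]_6) :
  form (cvec (2^-1 *: x) (- (2^-1 *: y))) (cvec (2^-1 *: x) (- (2^-1 *: y))) =
    (((form x x - form y y) / 4) +i* (- (form x y / 2)))%C.
Proof.
rewrite form_cvec !formE [form y x]formC.
by apply/eqP; rewrite eq_complex /=; apply/andP; split; apply/eqP; field.
Qed.

Lemma form_wirtinger_bar (x y : 'rV[R]_6) :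
  form (cvec (2^-1 *: x) (- (2^-1 *: y))) (cvec (2^-1 *: x) (2^-1 *: y)) =
    (((form x x + form y y) / 4) +i* 0)%C.
Proof.
rewrite form_cvec !formE [form y x]formC.
by apply/eqP; rewrite eq_complex /=; apply/andP; split; apply/eqP; field.
Qed.

Lemma complex_gt0 (a c : R) : (0 < (a +i* c)%C) = (c == 0) && (0 < a).
Proof. by rewrite ltcE. Qed.

Lemma conformalP (x y : 'rV[R]_6) :
  form (cvec (2^-1 *: x) (- (2^-1 *: y))) (cvec (2^-1 *: x) (- (2^-1 *: y))) = 0 /\
  0 < form (cvec (2^-1 *: x) (- (2^-1 *: y))) (cvec (2^-1 *: x) (2^-1 *: y)) <->
  [/\ form x x = form y y, form x y = 0 & 0 < form x x].
Proof.
rewrite form_wirtinger form_wirtinger_bar complex_gt0 eqxx /=; split.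
  move=> [/eqP]; rewrite eq_complex /= => /andP[/eqP e1 /eqP e2] e3.
  by split; lra.
move=> [-> -> e3]; split; last lra.
by apply/eqP; rewrite eq_complex /= subrr !mul0r oppr0 !eqxx.
Qed.

Lemma chain_rule_row z w p : is_lchart z -> is_lchart w -> dom z p -> dom w p ->
  holomorphic_transition z w ->
  exists a c : R, forall U, open U -> U `<=` dom w -> U p ->
    (forall f : M -> R, Cr w U 1 f ->
      isD z false f p (a * D w false f p + c * D w true f p) /\
      isD z true f p (- c * D w false f p + a * D w true f p)) /\
    (forall F, Cr w U 1 F ->
      D z false F p = a *: D w false F p + c *: D w true F p /\
      D z true F p = - c *: D w false F p + a *: D w true F p).
Proof.
move=> cz cw zp wp hol; have [a [c H]] := chain_rule cz cw zp wp hol.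
exists a, c => U oU Uw Up; split=> [f|F HF]; first exact: H.
have Hj j := H U _ oU Uw Up ((Cr_row cw oU Uw 1 F).1 HF j).
have E b j := D_row b j HF Up.
split; apply: isD_val; apply/isD_row => j; rewrite lincombE.
  by rewrite (E false) (E true); exact: (Hj j).1.
by rewrite (E false) (E true); exact: (Hj j).2.
Qed.

Lemma atlas_coordinate w : rs_atlas w -> coordinate w.
Proof. by move=> aw; split; [exact: rs_atlas_chart|move=> w' aw'; exact: rs_atlas_compatible]. Qed.

(** A coordinate is by definition compatible with the charts of the atlas only, so two coordinates
    are compared through an atlas chart around [p]. *)
Lemma coordinate_chain z z' p : coordinate z -> coordinate z' -> dom z p -> dom z' p ->
  exists a c : R, forall U F, open U -> U p -> smooth_on U F ->
    D z false F p = a *: D z' false F p + c *: D z' true F p /\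
    D z true F p = - c *: D z' false F p + a *: D z' true F p.
Proof.
move=> cz cz' zp z'p; have [w aw wp] := rs_atlas_cover p.
have cw := atlas_coordinate aw.
have [a [c H]] := chain_rule_row cz.1 cw.1 zp wp (cz.2 _ aw).1.
have [a' [c' H']] := chain_rule_row cw.1 cz'.1 wp z'p (cz'.2 _ aw).2.
exists (a * a' - c * c'), (a * c' + c * a') => U F oU Up sF.
have oUd v : coordinate v -> open (U `&` dom v).
  by move=> cv; apply: openI => //; exact: dom_open cv.1.
have [-> ->] := (H _ (oUd _ cw) (@subIsetr _ _ _) (conj Up wp)).2 F (smooth_on_Cr 1 cw sF).
have [-> ->] := (H' _ (oUd _ cz') (@subIsetr _ _ _) (conj Up z'p)).2 F (smooth_on_Cr 1 cz' sF).
exact: lincomb_comp.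
Qed.

(* The transition map z -> w, a + ic in complex notation, is recovered from a
   single conformal immersion Y by pairing with its derivatives; this makes the
   transition smooth without any appeal to Cauchy's theory. *)
Lemma smooth_transfer z w W Y : is_lchart z -> is_lchart w -> holomorphic_transition z w ->
  open W -> W `<=` dom z -> W `<=` dom w ->
  (forall k, Cr z W k Y) -> (forall k, Cr w W k Y) ->
  (forall q, W q -> [/\ form (D w false Y q) (D w false Y q) = form (D w true Y q) (D w true Y q),
     form (D w false Y q) (D w true Y q) = 0 & form (D w false Y q) (D w false Y q) != 0]) ->
  forall k (f : M -> R), (forall j, Cr w W j f) -> Cr z W k f.
Proof.
move=> cz cw hol oW Wz Ww zY wY conf; elim=> [|k IH] f Hf.
  by split=> // p Wp; exact: Cr_cont (Hf 0%N) Wp.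
have IHrow F : (forall j, Cr w W j F) -> Cr z W k F.
  move=> HF; apply/(Cr_row cz oW Wz) => j; apply: IH => i.
  by have /(Cr_row cw oW Ww) := HF i; exact.
pose r q := form (D w false Y q) (D w false Y q).
pose A b q := form (D z false Y q) (D w b Y q) * (r q)^-1.
(* The transition coefficients [A] involve [w]-derivatives of Y, to which the induction hypothesis
   applies just as to those of [f]. *)
have HD b : Cr z W k (D w b Y) by apply: IHrow => j; exact: Cr_D (wY j.+1).
have HA b : Cr z W k (A b).
  apply: (Cr_mul cz oW Wz); first by apply: (Cr_form cz oW Wz) => //; exact: Cr_D (zY k.+1).
  by apply: (Cr_inv cz oW Wz) => [q /conf[]|] //; exact: (Cr_form cz oW Wz).
have Hfd b : Cr z W k (D w b f) by apply: IH => j; exact: Cr_D (Hf j.+1).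
apply: (Cr_step cz oW Wz (df := fun b q => if b then -1 * A true q * D w false f q + A false q * D w true f q
    else A false q * D w false f q + A true q * D w true f q)) => [p Wp|b p Wp|b].
- exact: Cr_cont (Hf 0%N) Wp.
- have [a [c Hc]] := chain_rule_row cz cw (Wz _ Wp) (Ww _ Wp) hol.
  have [/(_ f (Hf 1%N))[Hu Hv] /(_ Y (wY 1%N))[Yu _]] := Hc W oW Ww Wp.
  have [e1 e2 e3] := conf p Wp.
  have e2' : form (D w true Y p) (D w false Y p) = 0 by rewrite formC.
  have Aa : A false p = a by rewrite /A Yu form_lincomb e2' mulr0 addr0 mulfK.
  have Ac : A true p = c by rewrite /A Yu form_lincomb e2 mulr0 add0r -e1 mulfK.
  by case: b; rewrite Aa Ac ?mulN1r.
- case: b; apply: (Cr_add cz oW Wz); apply: (Cr_mul cz oW Wz) => //.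
  by apply: (Cr_mul cz oW Wz) => //; exact: Cr_cst.
Qed.

Lemma lift_conformal y U Y z p : conformal_spacelike y -> local_lift y U Y ->
  coordinate z -> U p -> dom z p ->
  [/\ form (D z false Y p) (D z false Y p) = form (D z true Y p) (D z true Y p),
     form (D z false Y p) (D z true Y p) = 0 & 0 < form (D z false Y p) (D z false Y p)].
Proof.
move=> [_ H] lY cz Up zp; have := H U Y z p lY cz Up zp.
by rewrite Dz_cpx Dzbar_cpx => /conformalP.
Qed.

Lemma conformal_spacelikeI y : immersion y ->
  (forall U Y z p, local_lift y U Y -> coordinate z -> U p -> dom z p ->
    [/\ form (D z false Y p) (D z false Y p) = form (D z true Y p) (D z true Y p),
     form (D z false Y p) (D z true Y p) = 0 & 0 < form (D z false Y p) (D z false Y p)]) ->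
  conformal_spacelike y.
Proof.
move=> iy H; split=> // U Y z p lY cz Up zp.
by rewrite Dz_cpx Dzbar_cpx; apply/conformalP; exact: H lY cz Up zp.
Qed.

Lemma form_D_const z U F G k b p : is_lchart z -> open U -> U `<=` dom z ->
  Cr z U 1 F -> Cr z U 1 G -> (forall q, U q -> form (F q) (G q) = k) -> U p ->
  form (D z b F p) (G p) + form (F p) (D z b G p) = 0.
Proof.
move=> cz oU Uz HF HG H Up.
rewrite -(isD_val (isD_form cz (Uz _ Up) (Cr_isD b HF Up) (Cr_isD b HG Up))).
by rewrite (D_local b cz oU Uz Up H); apply: isD_val; exact: isD_cst.
Qed.

Lemma form_D_const0 z U F k b p : is_lchart z -> open U -> U `<=` dom z ->
  Cr z U 1 F -> (forall q, U q -> form (F q) (F q) = k) -> U p ->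
  form (F p) (D z b F p) = 0.
Proof.
move=> cz oU Uz HF H Up; have := form_D_const b cz oU Uz HF HF H Up.
by rewrite [form (D z b F p) _]formC; set t := form _ _; lra.
Qed.

(** The multiples of x drop out, x being null and orthogonal to its derivatives. *)
Lemma form_scaled (g gu gv a c : R) (x xu xv : 'rV[R]_6) :
  form x x = 0 -> form x xu = 0 -> form x xv = 0 -> form xu xu = form xv xv ->
  form xu xv = 0 -> g ^+ 2 * form xu xu = 1 ->
  let d := a *: (gu *: x + g *: xu) + c *: (gv *: x + g *: xv) in
  form d d = a ^+ 2 + c ^+ 2.
Proof.
move=> e1 e2 e3 e4 e5 e6 /=.
rewrite !formE [form xu x]formC [form xv x]formC [form xv xu]formC e1 e2 e3 e5 -e4.
by transitivity ((a ^+ 2 + c ^+ 2) * (g ^+ 2 * form xu xu)); [ring|rewrite e6 mulr1].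
Qed.

(** The factor is g = 1/|Y_u|, with u taken from [z]. The work lies in its smoothness in all other
    coordinates, which [local_lift] demands. *)
Lemma canonical_lift_near y U Y z p : conformal_spacelike y -> local_lift y U Y ->
  coordinate z -> U p -> dom z p ->
  exists g : M -> R, [/\ forall q, (U `&` dom z) q -> 0 < g q,
    forall k, Cr z (U `&` dom z) k g &
    canonical_lift y z (U `&` dom z) (fun q => g q *: Y q)].
Proof.
move=> cy lY cz Up zp; have [oU sY HY] := lY.
set W := U `&` dom z.
have oW : open W by apply: openI => //; exact: dom_open cz.1.
have conf v q : coordinate v -> U q -> dom v q -> _ := fun cv Uq vq => lift_conformal cy lY cv Uq vq.
pose r q := form (D z false Y q) (D z false Y q).
have oUv (V : set M) v : coordinate v -> open V -> open (V `&` dom v).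
  by move=> cv oV; apply: openI => //; exact: dom_open cv.1.
have zr k : Cr z W k r.
  have HD := Cr_D false (smooth_on_Cr k.+1 cz sY).
  exact: (Cr_form cz.1 oW (@subIsetr _ _ _) HD HD).
(* [r] is built from [z]-derivatives, hence smooth in [z]. Its smoothness is transferred from [z] to
   an atlas chart [w], then from [w] to [v]; Y itself is the conformal immersion that
   [smooth_transfer] calls for. *)
have wr v k : coordinate v -> Cr v (W `&` dom v) k r.
  move=> cv; apply: Cr_local => q [[Uq zq] vq].
  have [w aw wq] := rs_atlas_cover q; have cw := atlas_coordinate aw.
  set V := W `&` dom v `&` dom w.
  have oV : open V by exact (oUv _ _ cw (oUv _ _ cv oW)).
  exists V => //.
  have VU v' : coordinate v' -> V `<=` dom v' -> forall j, Cr v' V j Y.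
    move=> cv' Vv' j; apply: Cr_sub (smooth_on_Cr j cv' sY) => q' Vq'.
    by split; [case: Vq' => [[[]]]|exact: Vv'].
  have Vz : V `<=` dom z by move=> q' [[[]]].
  have Vv : V `<=` dom v by move=> q' [[[]]].
  have Vw : V `<=` dom w by move=> q' [[[]]].
  have cV v' : coordinate v' -> V `<=` dom v' -> forall q', V q' ->
    [/\ form (D v' false Y q') (D v' false Y q') = form (D v' true Y q') (D v' true Y q'),
     form (D v' false Y q') (D v' true Y q') = 0 & form (D v' false Y q') (D v' false Y q') != 0].
    move=> cv' Vv' q' Vq'; have Uq' : U q' by case: Vq' => [[[]]].
    have [e1 e2 e3] := conf v' q' cv' Uq' (Vv' _ Vq').
    by split; [exact: e1|exact: e2|exact: lt0r_neq0].
  have rw j : Cr w V j r.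
    apply: (smooth_transfer cw.1 cz.1 (cz.2 _ aw).2 oV Vw Vz (VU _ cw Vw) (VU _ cz Vz) (cV _ cz Vz)) => i.
    by apply: Cr_sub (zr i) => q' [[]].
  exact: (smooth_transfer cv.1 cw.1 (cv.2 _ aw).1 oV Vv Vw (VU _ cv Vv) (VU _ cw Vw) (cV _ cw Vw)).
have r0 q : W q -> 0 < r q by move=> [Uq zq]; have [] := conf z q cz Uq zq.
pose g q := (Num.sqrt (r q))^-1.
have g0 q : W q -> 0 < g q by move=> Wq; rewrite /g invr_gt0 sqrtr_gt0 r0.
have gr q : W q -> g q ^+ 2 * r q = 1.
  by move=> Wq; rewrite /g exprVn sqr_sqrtr ?mulVf ?gt_eqF ?ltW ?r0.
have wg v k : coordinate v -> Cr v (W `&` dom v) k g.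
  move=> cv.
  apply: (Cr_inv cv.1 (oUv _ _ cv oW) (@subIsetr _ _ _)) => [q [Wq _]|].
    by rewrite gt_eqF // sqrtr_gt0 r0.
  by apply: (Cr_sqrt cv.1 (oUv _ _ cv oW) (@subIsetr _ _ _)) => [q [Wq _]|]; [exact: r0|exact: wr].
have zg k : Cr z W k g by have := wg z k cz; rewrite /W -setIA setIid.
exists g; split=> //; split.
- split=> //.
    apply: Cr_smooth_on => v k cv.
    apply: (Cr_scale cv.1 (oUv _ _ cv oW) (@subIsetr _ _ _)); first exact: wg.
    by apply: Cr_sub (smooth_on_Cr k cv sY) => q [[Uq _] vq].
  move=> q Wq; have [Y0 Yn0 EY] := HY q Wq.1; have gn0 := lt0r_neq0 (g0 q Wq).
  split.
  - by rewrite /light_cone /= !formZl formZr Y0 !mulr0.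
  - by rewrite scaler_eq0 negb_or gn0.
  - rewrite EY; apply/eqP; rewrite eqEsubv; apply/andP; split.
      by apply/vlineP; exists (g q)^-1; rewrite scalerA mulVf // scale1r.
    by apply/vlineP; exists (g q).
- by move=> q [].
- move=> q Wq a c.
  have zY k := smooth_on_Cr k cz sY.
  have E b : D z b (fun q => g q *: Y q) q = D z b g q *: Y q + g q *: D z b Y q.
    by apply: isD_val; exact: (isD_scale cz.1 Wq.2 (Cr_isD b (zg 1%N) Wq) (Cr_isD b (zY 1%N) Wq)).
  have [e1 e2 e3] := conf z q cz Wq.1 Wq.2.
  have YY q' : W q' -> form (Y q') (Y q') = 0 by move=> [Uq' _]; have [] := HY q' Uq'.
  have YD b := form_D_const0 b cz.1 oW (@subIsetr _ _ _) (zY 1%N) YY Wq.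
  rewrite D_false D_true (E false) (E true).
  exact: (form_scaled _ _ _ _ (YY q Wq) (YD false) (YD true) e1 e2 (gr q Wq)).
Qed.
End Coordinates.

(** * Null sections of the normal bundle *)

Section PolarAlgebra.
Variable R : realType.
Implicit Types x l xu xv lu lv w t : 'rV[R]_6.

(** A dimension count: x, l, xu, xv are independent and the form is nondegenerate, so their
    orthogonal space has dimension 2. It contains x and l, which are independent, and so equals
    their span. *)
Lemma isotropic_perp x l xu xv w t :
  form x x = 0 -> form l l = 0 -> form l x = 0 -> form x xu = 0 -> form x xv = 0 ->
  form l xu = 0 -> form l xv = 0 -> form xu xv = 0 -> form xu xu != 0 -> form xv xv != 0 ->
  form x w != 0 -> form l w = 0 -> l != 0 ->
  form t x = 0 -> form t l = 0 -> form t xu = 0 -> form t xv = 0 ->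
  exists a c, t = a *: x + c *: l.
Proof.
move=> xx ll lx xxu xxv lxu lxv uv uu vv xw lw l0 tx tl txu txv.
pose A : 'M[R]_(4, 6) := \matrix_(i < 4) [:: x; l; xu; xv]`_i.
pose B : 'M[R]_(2, 6) := \matrix_(i < 2) [:: x; l]`_i.
(* [G] is the signature matrix times the transpose of [A], so its kernel is the orthogonal space of
   the rows of [A]. *)
pose G : 'M[R]_(6, 4) := \matrix_(i, j) ((-1) ^+ (4 <= i)%N * A j i).
have GE y j : (y *m G) 0 j = form y (row j A).
  by rewrite mxE; apply: eq_bigr => i _; rewrite !mxE; ring.
have AE (v : 'rV[R]_4) : v *m A = v 0 0 *: x + v 0 1 *: l + v 0 2 *: xu + v 0 3 *: xv.
  rewrite mulmx_sum_row !big_ord_recl big_ord0 addr0 !rowK /= !addrA.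
  by congr (v 0 _ *: _ + v 0 _ *: _ + v 0 _ *: _ + v 0 _ *: _); exact: val_inj.
have BE (v : 'rV[R]_2) : v *m B = v 0 0 *: x + v 0 1 *: l.
  rewrite mulmx_sum_row !big_ord_recl big_ord0 addr0 !rowK /=.
  by congr (v 0 _ *: _ + v 0 _ *: _); exact: val_inj.
(* Pairing with the null vectors x and l themselves would detect neither of them. The coefficient of
   x is found by pairing with [w], which is orthogonal to l; that of l then vanishes because l is
   nonzero. *)
have Afree (v : 'rV[R]_4) : v *m A = 0 -> v = 0.
  rewrite AE => H.
  have pair y : form (v 0 0 *: x + v 0 1 *: l + v 0 2 *: xu + v 0 3 *: xv) y = 0 by rewrite H form0l.
  have v2 : v 0 2 = 0.
    have := pair xu; rewrite !formE xxu lxu [form xv xu]formC uv !mulr0 !add0r addr0 => /eqP.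
    by rewrite mulf_eq0 (negPf uu) orbF => /eqP.
  have v3 : v 0 3 = 0.
    have := pair xv; rewrite !formE xxv lxv uv !mulr0 !add0r => /eqP.
    by rewrite mulf_eq0 (negPf vv) orbF => /eqP.
  have v0 : v 0 0 = 0.
    have := pair w; rewrite !formE lw v2 v3 !mul0r mulr0 !addr0 => /eqP.
    by rewrite mulf_eq0 (negPf xw) orbF => /eqP.
  have v1 : v 0 1 = 0.
    move: H; rewrite v0 v2 v3 !scale0r add0r !addr0 => /eqP.
    by rewrite scaler_eq0 (negPf l0) orbF => /eqP.
  apply/rowP => i; rewrite mxE; case: i => [[|[|[|[|//]]]] i4].
  - by rewrite -[RHS]v0; congr (v 0 _); exact: val_inj.
  - by rewrite -[RHS]v1; congr (v 0 _); exact: val_inj.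
  - by rewrite -[RHS]v2; congr (v 0 _); exact: val_inj.
  - by rewrite -[RHS]v3; congr (v 0 _); exact: val_inj.
(* The signature is invertible, so [G] has the rank of [A]. *)
have rG : \rank G = 4%N.
  rewrite -mxrank_tr; apply/eqP/inj_row_free => v vG.
  apply: Afree; apply/rowP => i; have /rowP/(_ i) := vG.
  rewrite !mxE => H; apply: (@mulfI _ ((-1) ^+ (4 <= i)%N)); first by rewrite signr_eq0.
  by rewrite mulr0 -[RHS]H mulr_sumr; apply: eq_bigr => j _; rewrite !mxE; ring.
have Bfree : \rank B = 2%N.
  apply/eqP/inj_row_free => v; rewrite BE => H.
  have v0 : v 0 0 = 0.
    have := congr1 (fun y : 'rV[R]_6 => form y w) H; rewrite !formE lw mulr0 addr0 => /eqP.
    by rewrite mulf_eq0 (negPf xw) orbF => /eqP.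
  have v1 : v 0 1 = 0.
    move: H; rewrite v0 scale0r add0r => /eqP.
    by rewrite scaler_eq0 (negPf l0) orbF => /eqP.
  apply/rowP => i; rewrite mxE; case: i => [[|[|//]] i2].
  - by rewrite -[RHS]v0; congr (v 0 _); exact: val_inj.
  - by rewrite -[RHS]v1; congr (v 0 _); exact: val_inj.
have BK : (B <= kermx G)%MS.
  apply/row_subP => i; apply/sub_kermxP/rowP => j; rewrite GE [RHS]mxE !rowK.
  by case: i => [[|[|//]] i2]; case: j => [[|[|[|[|//]]]] j4] //=; rewrite formC.
have KB : (kermx G <= B)%MS.
  by rewrite -(mxrank_leqif_sup BK).2 Bfree mxrank_ker rG.
have tK : (t <= kermx G)%MS.
  apply/sub_kermxP/rowP => j; rewrite GE [RHS]mxE rowK.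
  by case: j => [[|[|[|[|//]]]] j4].
have /submxP[v ->] := submx_trans tK KB.
by rewrite BE; exists (v 0 0), (v 0 1).
Qed.

(** Removing the components along xu and xv leaves a vector to which [isotropic_perp] applies. The
    values n and -m for [lv] express that the second fundamental form in direction l is symmetric
    and traceless. *)
Lemma polar_decomposition x l xu xv w lu lv (r m n : R) :
  form x x = 0 -> form l l = 0 -> form l x = 0 -> form x xu = 0 -> form x xv = 0 ->
  form l xu = 0 -> form l xv = 0 -> form xu xv = 0 -> form xu xu = r -> form xv xv = r ->
  r != 0 -> form x w != 0 -> form l w = 0 -> l != 0 ->
  form lu x = 0 -> form lv x = 0 -> form lu l = 0 -> form lv l = 0 ->
  form lu xu = m -> form lu xv = n -> form lv xu = n -> form lv xv = - m ->
  exists a c a' c', lu = (m / r) *: xu + (n / r) *: xv + (a *: x + c *: l) /\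
    lv = (n / r) *: xu - (m / r) *: xv + (a' *: x + c' *: l).
Proof.
move=> xx ll lx xxu xxv lxu lxv uv uu vv r0 xw lw l0 lux lvx lul lvl luu luv lvu lvv.
have uu0 : form xu xu != 0 by rewrite uu.
have vv0 : form xv xv != 0 by rewrite vv.
have [||||a [c E]] := isotropic_perp xx ll lx xxu xxv lxu lxv uv uu0 vv0 xw lw l0
  (t := lu - ((m / r) *: xu + (n / r) *: xv)).
- by rewrite !formE lux [form xu x]formC xxu [form xv x]formC xxv; ring.
- by rewrite !formE lul [form xu l]formC lxu [form xv l]formC lxv; ring.
- by rewrite !formE luu uu [form xv xu]formC uv; field.
- by rewrite !formE luv vv uv; field.
have [||||a' [c' E']] := isotropic_perp xx ll lx xxu xxv lxu lxv uv uu0 vv0 xw lw l0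
  (t := lv - ((n / r) *: xu - (m / r) *: xv)).
- by rewrite !formE lvx [form xu x]formC xxu [form xv x]formC xxv; ring.
- by rewrite !formE lvl [form xu l]formC lxu [form xv l]formC lxv; ring.
- by rewrite !formE lvu uu [form xv xu]formC uv; field.
- by rewrite !formE lvv vv uv; field.
exists a, c, a', c'; rewrite -E -E'; split; by rewrite addrC subrK.
Qed.

(** The plane of x and l is totally isotropic and orthogonal to xu and xv, so only tangential parts
    count; the matrix with rows (m, n) and (n, -m) is a similarity. *)
Lemma polar_norms x l xu xv lu lv (r m n a c a' c' : R) :
  form x x = 0 -> form l l = 0 -> form l x = 0 -> form x xu = 0 -> form x xv = 0 ->
  form l xu = 0 -> form l xv = 0 -> form xu xv = 0 -> form xu xu = r -> form xv xv = r ->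
  r != 0 ->
  lu = (m / r) *: xu + (n / r) *: xv + (a *: x + c *: l) ->
  lv = (n / r) *: xu - (m / r) *: xv + (a' *: x + c' *: l) ->
  [/\ form lu lu = (m ^+ 2 + n ^+ 2) / r, form lv lv = (m ^+ 2 + n ^+ 2) / r & form lu lv = 0].
Proof.
move=> xx ll lx xxu xxv lxu lxv uv uu vv r0 -> ->.
have [xux xvx] : form xu x = 0 /\ form xv x = 0 by rewrite ![form _ x]formC.
have [xul xvl] : form xu l = 0 /\ form xv l = 0 by rewrite ![form _ l]formC.
have [xl vu] : form x l = 0 /\ form xv xu = 0 by rewrite formC [form xv _]formC.
rewrite !formE xx ll lx xl xxu xxv lxu lxv uv vu uu vv xux xvx xul xvl.
by split; field.
Qed.

End PolarAlgebra.

(** * A lift of the surface paired with a lift of its polar surface *)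

Section PolarPair.
Variables (R : realType) (M : riemannSurface R).
Implicit Types (z : lchart R M) (W : set M) (p q : M) (b : bool) (Y L : M -> 'rV[R]_6).

(** Only first derivatives occur and Y need not be canonical, so that the relations survive a change
    of coordinate and a rescaling of Y. *)
Record polar_point z Y L q : Prop := PolarPoint {
  pp_YY : form (Y q) (Y q) = 0;
  pp_LL : form (L q) (L q) = 0;
  pp_L0 : L q != 0;
  pp_LY : form (L q) (Y q) = 0;
  pp_LDY : forall b, form (L q) (D z b Y q) = 0;
  pp_trace : form (D z false L q) (D z false Y q) + form (D z true L q) (D z true Y q) = 0;
  pp_iso : form (D z true Y q) (D z true Y q) = form (D z false Y q) (D z false Y q);
  pp_orth : form (D z false Y q) (D z true Y q) = 0;
  pp_pos : 0 < form (D z false Y q) (D z false Y q)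
}.

Record polar_pair z W Y L : Prop := PolarPair {
  pp_chart : is_lchart z;
  pp_open : open W;
  pp_sub : W `<=` dom z;
  pp_Y : forall k, Cr z W k Y;
  pp_L : forall k, Cr z W k L;
  pp_point : forall q, W q -> polar_point z Y L q
}.

Section Pair.
Variables (z : lchart R M) (W : set M) (Y L : M -> 'rV[R]_6).
Hypothesis YL : polar_pair z W Y L.
Let cz := pp_chart YL.
Let oW := pp_open YL.
Let Wz := pp_sub YL.
Let zY := pp_Y YL.
Let zL := pp_L YL.
Let pt := pp_point YL.

Let zDY b k : Cr z W k (D z b Y) := Cr_D b (zY k.+1).
Let zDL b k : Cr z W k (D z b L) := Cr_D b (zL k.+1).

Lemma pp_YDY b q : W q -> form (Y q) (D z b Y q) = 0.
Proof. by move=> Wq; exact: (form_D_const0 b cz oW Wz (zY 1%N) (fun q' Wq' => pp_YY (pt Wq')) Wq). Qed.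

Lemma pp_LDL b q : W q -> form (L q) (D z b L q) = 0.
Proof. by move=> Wq; exact: (form_D_const0 b cz oW Wz (zL 1%N) (fun q' Wq' => pp_LL (pt Wq')) Wq). Qed.

Lemma pp_DLY b q : W q -> form (D z b L q) (Y q) = 0.
Proof.
move=> Wq; have := form_D_const b cz oW Wz (zL 1%N) (zY 1%N) (fun q' Wq' => pp_LY (pt Wq')) Wq.
by rewrite (pp_LDY (pt Wq)) addr0.
Qed.

Lemma pp_DLDY b b' q : W q -> form (D z b L q) (D z b' Y q) = - form (L q) (D z b (D z b' Y) q).
Proof.
move=> Wq; apply/eqP; rewrite -addr_eq0; apply/eqP.
exact: (form_D_const b cz oW Wz (zL 1%N) (zDY b' 1%N) (fun q' Wq' => pp_LDY (pt Wq') b') Wq).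
Qed.

Lemma pp_YDDY b b' q : W q -> form (Y q) (D z b (D z b' Y) q) = - form (D z b Y q) (D z b' Y q).
Proof.
move=> Wq; apply/eqP; rewrite -addr_eq0 addrC; apply/eqP.
exact: (form_D_const b cz oW Wz (zY 1%N) (zDY b' 1%N) (fun q' Wq' => pp_YDY b' Wq') Wq).
Qed.

Lemma pp_DLDY_sym q : W q -> form (D z true L q) (D z false Y q) = form (D z false L q) (D z true Y q).
Proof. by move=> Wq; rewrite !pp_DLDY // (D_comm cz oW Wz (zY 2%N) Wq). Qed.

Definition laplacian q := D z false (D z false Y) q + D z true (D z true Y) q.

(** The value is -2|Y_u|^2. The Laplacian of Y thus serves as the vector [w] that separates Y from
    L. *)
Lemma pp_Ylap q : W q -> form (Y q) (laplacian q) != 0.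
Proof.
move=> Wq; rewrite formDr !pp_YDDY // (pp_iso (pt Wq)).
have := pp_pos (pt Wq); set r := form _ _ => r0.
by rewrite -opprD oppr_eq0 gt_eqF // addr_gt0.
Qed.

Lemma pp_Llap q : W q -> form (L q) (laplacian q) = 0.
Proof.
move=> Wq; rewrite formDr; have := pp_trace (pt Wq); rewrite !pp_DLDY //.
by set s := form _ _; set t := form _ _; lra.
Qed.

Lemma pp_decomposition q : W q ->
  let r := form (D z false Y q) (D z false Y q) in
  let m := form (D z false L q) (D z false Y q) in
  let n := form (D z false L q) (D z true Y q) in
  exists a c a' c',
    D z false L q = (m / r) *: D z false Y q + (n / r) *: D z true Y q + (a *: Y q + c *: L q) /\
    D z true L q = (n / r) *: D z false Y q - (m / r) *: D z true Y q + (a' *: Y q + c' *: L q).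
Proof.
move=> Wq r m n; have P := pt Wq.
apply: (polar_decomposition (w := laplacian q) (pp_YY P) (pp_LL P) (pp_LY P) (pp_YDY _ Wq)
  (pp_YDY _ Wq) (pp_LDY P _) (pp_LDY P _) (pp_orth P) (erefl r) (pp_iso P) (lt0r_neq0 (pp_pos P))
  (pp_Ylap Wq) (pp_Llap Wq) (pp_L0 P) (pp_DLY _ Wq) (pp_DLY _ Wq) _ _ (erefl m) (erefl n)
  (pp_DLDY_sym Wq) _).
- by rewrite formC pp_LDL.
- by rewrite formC pp_LDL.
- by apply/eqP; rewrite -addr_eq0 addrC; apply/eqP; exact: pp_trace P.
Qed.

Lemma pp_norms q : W q ->
  let r := form (D z false Y q) (D z false Y q) in
  let m := form (D z false L q) (D z false Y q) in
  let n := form (D z false L q) (D z true Y q) in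
  [/\ form (D z false L q) (D z false L q) = (m ^+ 2 + n ^+ 2) / r,
   form (D z true L q) (D z true L q) = (m ^+ 2 + n ^+ 2) / r &
   form (D z false L q) (D z true L q) = 0].
Proof.
move=> Wq r m n; have P := pt Wq; have [a [c [a' [c' [Eu Ev]]]]] := pp_decomposition Wq.
exact: (polar_norms (pp_YY P) (pp_LL P) (pp_LY P) (pp_YDY _ Wq)
  (pp_YDY _ Wq) (pp_LDY P _) (pp_LDY P _) (pp_orth P) (erefl r) (pp_iso P) (lt0r_neq0 (pp_pos P)) Eu Ev).
Qed.


(** * Canonical lifts: the mixed derivative of the polar lift *)

Section Canonical.
Hypothesis Yunit : forall q, W q -> form (D z false Y q) (D z false Y q) = 1.
Hypothesis Lunit : forall q, W q -> form (D z false L q) (D z false L q) = 1.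
Hypothesis Yuv : forall q, W q -> exists s, D z true (D z false Y) q = s *: Y q.

Let mu b q := form (D z b L q) (D z b Y q).
(** The coefficient of L in L_b, obtained by pairing L_b with Y_bb. The coefficients in
    [pp_decomposition] merely exist at each point; this explicit formula is smooth and can be
    differentiated. *)
Let gam b q := - (mu b q / 2) * form (D z b L q) (D z b (D z b Y) q).

Let Ymixed q : W q -> exists s, forall b, D z (~~ b) (D z b Y) q = s *: Y q.
Proof.
move=> Wq; have [s E] := Yuv Wq; exists s; case=> //=.
by rewrite -(D_comm cz oW Wz (zY 2%N) Wq).
Qed.

Let Yunitb b q : W q -> form (D z b Y q) (D z b Y q) = 1.
Proof. by move=> Wq; case: b; rewrite ?(pp_iso (pt Wq)) Yunit. Qed.

Let Yorthb b q : W q -> form (D z b Y q) (D z (~~ b) Y q) = 0.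
Proof. by move=> Wq; case: b; rewrite /= ?[form (D z true Y q) _]formC (pp_orth (pt Wq)). Qed.

Let cross b q : W q -> form (D z b L q) (D z (~~ b) Y q) = 0.
Proof.
move=> Wq; have [s E] := Ymixed Wq; rewrite pp_DLDY // -{1}(negbK b) E formZr.
by rewrite (pp_LY (pt Wq)) mulr0 oppr0.
Qed.

Let mu_neg b q : W q -> mu (~~ b) q = - mu b q.
Proof.
move=> Wq; have := pp_trace (pt Wq); rewrite -/(mu false q) -/(mu true q).
by move=> /eqP; rewrite addr_eq0 => /eqP; case: b => /= ->; rewrite ?opprK.
Qed.

Let mut q : W q -> mu true q = - mu false q.
Proof. exact: (mu_neg false). Qed.

Let mu_sqr b q : W q -> mu b q ^+ 2 = 1.
Proof.
move=> Wq; have m1 : mu false q ^+ 2 = 1.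
  have [] := pp_norms Wq; rewrite Lunit // Yunit // (cross false Wq) divr1 expr0n addr0.
  by move=> <-.
by case: b => //; rewrite mut // sqrrN.
Qed.

Let zmu b k : Cr z W k (mu b) := Cr_form cz oW Wz (zDL b k) (zDY b k).

(** Differentiate mu^2 = 1 and divide by 2 mu. *)
Let Dmu b b' q : W q -> D z b' (mu b) q = 0.
Proof.
move=> Wq; have Hm := Cr_isD b' (zmu b 1%N) Wq.
have := isD_val (isD_mul cz (Wz Wq) Hm Hm).
rewrite (_ : D z b' _ q = D z b' (fun _ => 1 : R) q); last first.
  by apply: (D_local b' cz oW Wz Wq) => q' Wq'; rewrite -expr2 mu_sqr.
rewrite (isD_val (isD_cst _ _ _ _)) [X in _ + X]mulrC -mulr2n => /esym/eqP.
rewrite mulrn_eq0 mulf_eq0 /= => /orP[/eqP//|/eqP m0].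
by have := mu_sqr b Wq; rewrite m0 expr0n /= => /esym/eqP; rewrite oner_eq0.
Qed.

(** With e the other direction, differentiating <L_b,Y_e> = 0 along e gives <L_be,Y_e> + <L_b,Y_ee>
    = 0. The first term vanishes, by differentiating the constant <L_e,Y_e> along b, since Y_eb is a
    multiple of Y and <L_e,Y> = 0. *)
Let L_bee b q : W q -> form (D z b L q) (D z (~~ b) (D z (~~ b) Y) q) = 0.
Proof.
move=> Wq; have H := form_D_const (~~ b) cz oW Wz (zDL b 1%N) (zDY (~~ b) 1%N) (cross b) Wq.
have He := isD_val (isD_form cz (Wz Wq) (Cr_isD b (zDL (~~ b) 1%N) Wq) (Cr_isD b (zDY (~~ b) 1%N) Wq)).
have [s E] := Ymixed Wq.
have Eb : D z b (D z (~~ b) Y) q = s *: Y q by rewrite -{1}(negbK b) E.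
have C : D z b (D z (~~ b) L) q = D z (~~ b) (D z b L) q.
  by have := D_comm cz oW Wz (zL 2%N) Wq; case: (b) => /= ->.
move: He; rewrite -/(mu (~~ b)) Dmu // Eb formZr pp_DLY // mulr0 addr0 C => He.
by move: H; rewrite -He add0r.
Qed.

Let Y_bee b q : W q -> form (D z b Y q) (D z (~~ b) (D z (~~ b) Y) q) = 0.
Proof.
move=> Wq; have := form_D_const (~~ b) cz oW Wz (zDY b 1%N) (zDY (~~ b) 1%N) (Yorthb b) Wq.
by have [s ->] := Ymixed Wq; rewrite formZl pp_YDY // mulr0 add0r.
Qed.

Let Y_bbb b q : W q -> form (D z b Y q) (D z b (D z b Y) q) = 0.
Proof. by move=> Wq; exact: (form_D_const0 b cz oW Wz (zDY b 1%N) (Yunitb b) Wq). Qed.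

Let DL_span b q : W q -> exists a c, D z b L q = mu b q *: D z b Y q + (a *: Y q + c *: L q).
Proof.
move=> Wq; have [a [c [a' [c' [Eu Ev]]]]] := pp_decomposition Wq.
move: Eu Ev; rewrite Yunit // (cross false Wq) !divr1 !scale0r addr0 sub0r -scaleNr.
rewrite -/(mu false q) -(mut Wq) => Eu Ev.
by case: b; [exists a', c'|exists a, c].
Qed.

(** Write L_b = mu Y_b + a Y + c L. Pairing with Y_ee, e being the other direction, gives a = c mu;
    pairing with Y_bb then gives -2 c mu, hence c = [gam], as mu^2 = 1. *)
Let DL_formula b q : W q ->
  D z b L q = mu b q *: D z b Y q + (mu b q * gam b q) *: Y q + gam b q *: L q.
Proof.
move=> Wq; have [a [c E]] := DL_span b Wq.
have Lbb : form (L q) (D z b (D z b Y) q) = - mu b q by rewrite /mu pp_DLDY // opprK.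
have Lee : form (L q) (D z (~~ b) (D z (~~ b) Y) q) = mu b q.
  by rewrite -[LHS]opprK -pp_DLDY // -/(mu (~~ b) q) mu_neg // opprK.
have e1 : a = c * mu b q.
  have := L_bee b Wq; rewrite E 2!formDl 3!formZl Y_bee // Lee pp_YDDY // Yunitb //.
  by move=> H; lra.
have e2 : gam b q = c.
  rewrite /gam E 2!formDl 3!formZl Y_bbb // Lbb pp_YDDY // Yunitb // e1.
  have := mu_sqr b Wq; set m := mu b q => m1.
  by transitivity (c * m ^+ 2); [field|rewrite m1 mulr1].
by rewrite e2 {1}E e1 addrA [c * _]mulrC.
Qed.

(** The left side is what the product rule yields for the derivative of [DL_formula] in the other
    direction; the 0 is the derivative of mu, and the sign in the hypothesis comes from [mu_neg]. *)
Lemma mixed_formula (m s g g' d : R) (x l xe le : 'rV[R]_6) :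
  le = - m *: xe + (- m * g') *: x + g' *: l ->
  m *: (s *: x) + ((0 * g + m * d) *: x + (m * g) *: xe) + (d *: l + g *: le) =
  (m * (s + d - g * g')) *: x + (d + g * g') *: l.
Proof. by move=> ->; apply/rowP => j; rewrite !mxE; ring. Qed.

Let zgam b k : Cr z W k (gam b).
Proof.
apply: (Cr_mul cz oW Wz); last exact: (Cr_form cz oW Wz (zDL b k) (Cr_D b (zDY b k.+1))).
have -> : (fun q => - (mu b q / 2)) = (fun q => - 2^-1 * mu b q).
  by apply/funext => q; ring.
exact: (Cr_mul cz oW Wz (Cr_cst cz oW Wz k _) (zmu b k)).
Qed.

Let DDL b q s : W q -> (forall b, D z (~~ b) (D z b Y) q = s *: Y q) ->
  let k := gam b q * gam (~~ b) q in let d := D z (~~ b) (gam b) q in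
  D z (~~ b) (D z b L) q = (mu b q * (s + d - k)) *: Y q + (d + k) *: L q.
Proof.
move=> Wq Hs k d; set e := ~~ b.
rewrite (D_local e cz oW Wz Wq (DL_formula b)).
have Hm := Cr_isD e (zmu b 1%N) Wq; have Hg := Cr_isD e (zgam b 1%N) Wq.
have zq := Wz Wq.
have := isD_add (isD_add (isD_scale cz zq Hm (Cr_isD e (zDY b 1%N) Wq))
  (isD_scale cz zq (isD_mul cz zq Hm Hg) (Cr_isD e (zY 1%N) Wq)))
  (isD_scale cz zq Hg (Cr_isD e (zL 1%N) Wq)).
move=> /isD_val ->; rewrite Dmu // Hs scale0r add0r.
have := DL_formula e Wq; rewrite /e mu_neg //; exact: mixed_formula.
Qed.

Lemma pp_Luv q : W q -> exists w, D z true (D z false L) q = w *: L q.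
Proof.
move=> Wq; have [s Hs] := Ymixed Wq.
have E1 := DDL false Wq Hs; have E2 := DDL true Wq Hs.
move: E1 E2 => /=; rewrite -(D_comm cz oW Wz (zL 2%N) Wq) (mut Wq) [gam true q * _]mulrC.
set k := gam false q * _; set m := mu false q; set d := D z true (gam false) q; set d' := D z false (gam true) q => E1 E2.
have Ylap := pp_Ylap Wq; have Llap := pp_Llap Wq.
(* Pairing with the Laplacian of Y kills L but not Y, and so isolates the coefficient of Y. *)
have e1 : m * (s + d - k) = - m * (s + d' - k).
  have := congr1 (fun t => form t (laplacian q)) (etrans (esym E1) E2).
  by rewrite /= 2!formDl 4!formZl Llap !mulr0 !addr0 => /(mulIf Ylap).
have e2 : d = d'.
  move: (etrans (esym E1) E2); rewrite e1 => /addrI /eqP.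
  by rewrite -subr_eq0 -scalerBl scaler_eq0 (negPf (pp_L0 (pt Wq))) orbF => /eqP; lra.
(* As mu changes sign between the two directions, the coefficient of Y equals its own opposite. *)
have e3 : m * (s + d - k) = 0 by move: e1; rewrite -e2; lra.
by exists (d + k); rewrite E1 e3 scale0r add0r.
Qed.

End Canonical.
End Pair.
End PolarPair.

(** * Polar surfaces *)

Section Polar.
Variables (R : realType) (M : riemannSurface R).
Implicit Types (z : lchart R M) (U W : set M) (p q : M) (b : bool).
Implicit Types (y l : M -> quadric R) (Y L X : M -> 'rV[R]_6).

Lemma D_scale z W b a Y p : is_lchart z -> W `<=` dom z -> Cr z W 1 Y -> W p ->
  D z b (fun q => a *: Y q) p = a *: D z b Y p.
Proof.
move=> cz Wz HY Wp; have zp := Wz _ Wp.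
have := isD_val (isD_scale cz zp (isD_cst z b p (a : R)) (Cr_isD b HY Wp)).
by rewrite scale0r add0r.
Qed.

Lemma D_opp_scale z W b a Y p : is_lchart z -> W `<=` dom z -> Cr z W 1 Y -> W p ->
  D z b (fun q => - (a *: Y q)) p = - (a *: D z b Y p).
Proof.
move=> cz Wz HY Wp; rewrite -scaleNr -(D_scale b _ cz Wz HY Wp).
by congr (D z b _ p); apply/funext => q; rewrite scaleNr.
Qed.

Lemma Dz_cpx_fun z Y :
  Dz z (@cpx R \o Y) = fun q => cvec (2^-1 *: D z false Y q) (- (2^-1 *: D z true Y q)).
Proof. by apply/funext => q; exact: Dz_cpx. Qed.

Lemma laplacian_cvec (a c : 'rV[R]_6) :
  2^-1 *: (2^-1 *: a - - (2^-1 *: c)) = 4^-1 *: (a + c).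
Proof. by apply/rowP => j; rewrite !mxE; field. Qed.

Lemma Dzz_cvec (a c d : 'rV[R]_6) :
  cvec (2^-1 *: (2^-1 *: a + - (2^-1 *: c))) (2^-1 *: (- (2^-1 *: d) - 2^-1 *: d)) =
  cvec (4^-1 *: (a - c)) (- (2^-1 *: d)).
Proof. by congr cvec; apply/rowP => j; rewrite !mxE; field. Qed.

Section Second.
Variables (z : lchart R M) (W : set M) (Y : M -> 'rV[R]_6).
Hypothesis cz : is_lchart z.
Hypothesis oW : open W.
Hypothesis Wz : W `<=` dom z.
Hypothesis zY : forall k, Cr z W k Y.

Lemma Dzzbar_laplacian p : W p -> Dzzbar z Y p = 4^-1 *: laplacian z Y p.
Proof.
move=> Wp; have HD b := Cr_D b (zY 2%N).
rewrite /Dzzbar Dz_cpx_fun Dzbar_cvec rvec_cvec.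
rewrite (D_scale _ _ cz Wz (HD _) Wp) (D_opp_scale _ _ cz Wz (HD _) Wp).
exact: laplacian_cvec.
Qed.

Lemma Dzz_formula p : W p ->
  Dz z (Dz z (@cpx R \o Y)) p =
  cvec (4^-1 *: (D z false (D z false Y) p - D z true (D z true Y) p))
       (- (2^-1 *: D z true (D z false Y) p)).
Proof.
move=> Wp; have HD b := Cr_D b (zY 2%N).
rewrite Dz_cpx_fun Dz_cvec !(D_scale _ _ cz Wz (HD _) Wp) !(D_opp_scale _ _ cz Wz (HD _) Wp).
by rewrite -(D_comm cz oW Wz (zY 2%N) Wp) Dzz_cvec.
Qed.

Lemma VperpP p (x : 'rV[R]_6) : W p ->
  Vperp z Y p x <-> [/\ form x (Y p) = 0, forall b, form x (D z b Y p) = 0 &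
    form x (laplacian z Y p) = 0].
Proof.
move=> Wp; rewrite /Vperp /Vsp /= Dz_cpx rvec_cvec ivec_cvec (Dzzbar_laplacian Wp).
set u := D z false Y p; set v := D z true Y p; set w := laplacian z Y p.
have two0 : (2 : R) != 0 by rewrite pnatr_eq0.
have four0 : (4 : R) != 0 by rewrite pnatr_eq0.
split=> [H|[xY xD xl] t].
  have xY : form x (Y p) = 0 by apply: H; apply: memv_span; rewrite inE eqxx.
  have : form x (2^-1 *: u) = 0 by apply: H; apply: memv_span; rewrite !inE eqxx !orbT.
  have : form x (- (2^-1 *: v)) = 0 by apply: H; apply: memv_span; rewrite !inE eqxx !orbT.
  have : form x (4^-1 *: w) = 0 by apply: H; apply: memv_span; rewrite !inE eqxx !orbT.
  rewrite formNr !formZr => xw xv xu.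
  split=> //; last lra.
  by case; lra.
rewrite !span_cons span_nil addv0 => /memv_addP[_ /vlineP[k1 ->] [_ /memv_addP[_ /vlineP[k2 ->]
  [_ /memv_addP[_ /vlineP[k3 ->] [_ /vlineP[k4 ->] ->]] ->]] ->]].
by rewrite !formDr formZr xY !formZr formNr !formZr (xD false) (xD true) xl !mulr0 oppr0 mulr0 !addr0.
Qed.

End Second.


(** The property common to left and right polar surfaces. Nullity and smoothness are supplied later
    by a local lift of [l], to which [X] is proportional at each point. *)
Definition normal_section y l : Prop := forall p, exists z U Y X,
  [/\ coordinate z, U p, canonical_lift y z U Y &
    forall q, U q -> Vperp z Y q (X q) /\ qline (l q) = <[X q]>%VS].

Lemma left_polar_normal o y l : left_polar o y l -> normal_section y l.
Proof.
move=> H p; have [z [U [Y [L [Rt [cz Up cY [_ _ nf] lL]]]]]] := H p.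
exists z, U, Y, L; split=> // q Uq; have [VL _ _ _ _] := nf q Uq.
by split; [exact: VL|exact: lL].
Qed.

Lemma right_polar_normal o y l : right_polar o y l -> normal_section y l.
Proof.
move=> H p; have [z [U [Y [L [Rt [cz Up cY [_ _ nf] lR]]]]]] := H p.
exists z, U, Y, Rt; split=> // q Uq; have [_ VR _ _ _] := nf q Uq.
by split; [exact: VR|exact: lR].
Qed.

(** Under a conformal change of coordinate the trace is multiplied by a^2 + c^2. *)
Lemma form_rotation (a c : R) (u v u' v' : 'rV[R]_6) : form u u' + form v v' = 0 ->
  form (a *: u + c *: v) (a *: u' + c *: v') + form (- c *: u + a *: v) (- c *: u' + a *: v') = 0.
Proof.
move=> H; rewrite !formE.
by transitivity ((a ^+ 2 + c ^+ 2) * (form u u' + form v v')); [ring|rewrite H mulr0].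
Qed.

(** The relations are known in the coordinate z' that comes with the normal section. They pass from
    [X] to the proportional lift [L] while still in z', and only then to [z], with the same lift Y,
    in general no longer canonical. *)
Lemma polar_pair_exists y l U L z p : conformal_spacelike y -> normal_section y l ->
  coordinate z -> local_lift l U L -> U p -> dom z p ->
  exists W Y, [/\ W p, W `<=` U `&` dom z, local_lift y W Y & polar_pair z W Y L].
Proof.
move=> cy nl cz lL Up zp; have [oU sL HL] := lL.
have [z' [U' [Y [X [cz' U'p cY nX]]]]] := nl p.
have [[oU' sY HY] U'z' _] := cY.
set W := U `&` U' `&` dom z.
have oW : open W by do 2?apply: openI => //; exact: dom_open cz.1.
have WU : W `<=` U by move=> q [[]].
have WU' : W `<=` U' by move=> q [[]].
have Wz : W `<=` dom z by move=> q [].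
have Wz' : W `<=` dom z' by move=> q /WU' /U'z'.
have sub (V : set M) v F k : W `<=` V -> W `<=` dom v -> coordinate v -> smooth_on V F -> Cr v W k F.
  by move=> WV Wv cv sF; apply: Cr_sub (smooth_on_Cr k cv sF) => q Wq; split; [exact: WV|exact: Wv].
have zY k : Cr z W k Y by exact: sub WU' Wz cz sY.
have zL k : Cr z W k L by exact: sub WU Wz cz sL.
have zY' k : Cr z' W k Y by exact: sub WU' Wz' cz' sY.
have zL' k : Cr z' W k L by exact: sub WU Wz' cz' sL.
have lY : local_lift y W Y.
  split=> //; last by move=> q /WU'; exact: HY.
  by apply: Cr_smooth_on => v k cv; apply: Cr_sub (smooth_on_Cr k cv sY) => q [/WU' ? ?].
exists W, Y; split=> //; first by move=> q Wq; split; [exact: WU|exact: Wz].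
have perp q : W q -> [/\ form (L q) (Y q) = 0, forall b, form (L q) (D z' b Y q) = 0 &
    form (L q) (laplacian z' Y q) = 0].
  move=> Wq; have [VX EX] := nX q (WU' _ Wq).
  have [Xy XD Xl] := (VperpP cz'.1 Wz' zY' _ Wq).1 VX.
  have [_ _ EL] := HL q (WU _ Wq).
  have /vlineP[k ->] : L q \in <[X q]>%VS by rewrite -EX EL memv_line.
  by split=> [|b|]; rewrite formZl ?Xy ?XD ?Xl mulr0.
(* The Laplacian relation is converted to first order in z', where it is known, before the
   coordinate changes. *)
have trace q : W q -> form (D z' false L q) (D z' false Y q) + form (D z' true L q) (D z' true Y q) = 0.
  move=> Wq; have [_ _] := perp q Wq; rewrite formDr.
  have H b : form (D z' b L q) (D z' b Y q) + form (L q) (D z' b (D z' b Y) q) = 0.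
    apply: (form_D_const b cz'.1 oW Wz' (zL' 1%N) (Cr_D b (zY' 2%N)) _ Wq) => q' Wq'.
    by have [_ H _] := perp q' Wq'; exact: H.
  have := H false; have := H true.
  by set a := form _ _; set c := form _ _; set d := form _ _; set e := form _ _; lra.
split=> // [|q Wq]; first exact: cz.1.
have [a [c Hac]] := coordinate_chain cz cz' (Wz _ Wq) (Wz' _ Wq).
have [EuL EvL] := Hac U L oU (WU _ Wq) sL.
have [EuY EvY] := Hac U' Y oU' (WU' _ Wq) sY.
have [LY LD _] := perp q Wq.
have [e1 e2 e3] := lift_conformal cy lY cz Wq (Wz _ Wq).
have [LL L0 _] := HL q (WU _ Wq); have [YY _ _] := HY q (WU' _ Wq).
split=> //.
- by case; rewrite ?EuY ?EvY formDr !formZr !LD !mulr0 addr0.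
- by rewrite EuL EvL EuY EvY; exact: form_rotation (trace q Wq).
Qed.

End Polar.

(** * Conformality, umbilics and adapted coordinates of the polar surface *)

Section Isothermic.
Variables (R : realType) (M : riemannSurface R).
Implicit Types (z : lchart R M) (U W : set M) (p q : M) (b : bool).
Implicit Types (y l : M -> quadric R) (Y L X : M -> 'rV[R]_6).

Lemma vpick_line (x : 'rV[R]_6) : x != 0 -> exists2 k : R, k != 0 & vpick <[x]>%VS = k *: x.
Proof.
move=> x0; have /vlineP[k E] := memv_pick <[x]>%VS.
exists k => //; apply: contra_neq x0 => k0; apply/eqP.
have /eqP x0 : <[x]>%VS == 0%VS by rewrite -vpick0 E k0 scale0r.
by rewrite -memv0 -x0 memv_line.
Qed.

(** [vpick] returns an unspecified vector of the line; normalizing one coordinate cancels the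
    unknown factor. *)
Lemma lift_aff l U L q i : local_lift l U L -> U q ->
  aff i (l q) = (L q 0 i)^-1 *: L q /\ (L q 0 i != 0 -> aff_dom i (l q)).
Proof.
move=> [_ _ HL] Uq; have [_ L0 E] := HL q Uq; have [k k0 Ek] := vpick_line L0.
rewrite /aff /aff_dom E Ek !mxE; split=> [|Li]; last by rewrite mulf_neq0.
by rewrite scalerA invfM mulrAC mulVf // mul1r.
Qed.

(** In the span of x and l, the vectors with vanishing i-th coordinate form a space of dimension at
    most 1, since l is not among them. *)
Lemma free2_dependent (x l u v : 'rV[R]_6) (a c a' c' : R) i : l 0 i != 0 ->
  u = a *: x + c *: l -> v = a' *: x + c' *: l -> u 0 i = 0 -> v 0 i = 0 ->
  free [:: u; v] = false.
Proof.
move=> li Eu Ev ui vi; apply/negbTE/negP.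
rewrite free_cons span_seq1 seq1_free => /andP[uv v0].
have [a0|a0] := eqVneq a' 0.
  move/eqP: v0; apply; rewrite Ev a0 scale0r add0r.
  move: vi; rewrite Ev a0 scale0r add0r mxE => /eqP.
  by rewrite mulf_eq0 (negPf li) orbF => /eqP ->; rewrite scale0r.
move/negP: uv; apply; apply/vlineP; exists (a / a').
have E : u - (a / a') *: v = (c - a / a' * c') *: l.
  by rewrite Eu Ev; apply/rowP => j; rewrite !mxE; field.
apply/eqP; rewrite -subr_eq0 E scaler_eq0; apply/orP; left.
have : (u - (a / a') *: v) 0 i = 0 by rewrite !mxE ui vi; ring.
by rewrite E mxE => /eqP; rewrite mulf_eq0 (negPf li) orbF.
Qed.

(** If m = n = 0, then L_u and L_v lie in the span of Y and L, and so do the derivatives of the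
    affine representative L / L_i. These also have i-th coordinate 0, hence are dependent, against
    the immersion hypothesis. *)
Lemma polar_regular l U W L Y z q : immersion l -> local_lift l U L -> coordinate z ->
  W `<=` U -> polar_pair z W Y L -> W q ->
  ~ (form (D z false L q) (D z false Y q) = 0 /\ form (D z false L q) (D z true Y q) = 0).
Proof.
move=> [_ il] lL cz WU YL Wq [m0 n0].
have [a [c [a' [c' [Eu Ev]]]]] := pp_decomposition YL Wq.
move: Eu Ev; rewrite m0 n0 !mul0r !scale0r subr0 !add0r => Eu Ev.
have [_ oW Wz _ zL pt] := YL; have L0 := pp_L0 (pt q Wq).
have [i Li] : exists i, L q 0 i != 0.
  by apply/existsP; apply: contraNT L0 => /existsPn H; apply/eqP/rowP => i; rewrite mxE;
    have := H i; rewrite negbK => /eqP.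
have [_ /(_ Li) ad] := lift_aff i lL (WU _ Wq).
have := il z q i cz (Wz _ Wq) ad; rewrite D_false D_true.
have EA b : D z b (aff i \o l) q =
    - ((L q 0 i)^-1 * (L q 0 i)^-1 * (D z b L q) 0 i) *: L q + (L q 0 i)^-1 *: D z b L q.
  rewrite (D_local b cz.1 oW Wz Wq (fun q' Wq' => (lift_aff i lL (WU _ Wq')).1)).
  have HL := Cr_isD b (zL 1%N) Wq; have zq := Wz _ Wq.
  by apply: isD_val; apply: isD_scale => //; [exact: cz.1|
    apply: isD_inv => //; [exact: cz.1|move/isD_row: HL; exact]].
rewrite (EA false) (EA true).
set g := (L q 0 i)^-1; have comp (t : 'rV[R]_6) : (- (g * g * t 0 i) *: L q + g *: t) 0 i = 0.
  by rewrite !mxE; move: Li; rewrite /g => Li; field.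
rewrite (free2_dependent (x := Y q) (l := L q) (a := g * a) (c := g * c - g * g * D z false L q 0 i)
  (a' := g * a') (c' := g * c' - g * g * D z true L q 0 i) Li _ _ (comp _) (comp _)) //.
- by rewrite {2}Eu scalerDr !scalerA scalerBl scaleNr addrC addrA.
- by rewrite {2}Ev scalerDr !scalerA scalerBl scaleNr addrC addrA.
Qed.

Lemma sum_sqr_eq0 (m n : R) : m ^+ 2 + n ^+ 2 = 0 -> m = 0 /\ n = 0.
Proof.
move=> /eqP; rewrite paddr_eq0 ?sqr_ge0 // !sqrf_eq0 => /andP[/eqP -> /eqP ->].
by [].
Qed.

Lemma normal_conformal y l : conformal_spacelike y -> normal_section y l -> immersion l ->
  conformal_spacelike l.
Proof.
move=> cy nl il; apply: conformal_spacelikeI => // U L z p lL cz Up zp.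
have [W [Y [Wp WUz lY YL]]] := polar_pair_exists cy nl cz lL Up zp.
have [-> -> ->] := pp_norms YL Wp; split=> //.
have reg := polar_regular il lL cz (fun q Wq => (WUz q Wq).1) YL Wp.
apply: divr_gt0; last exact: pp_pos (pp_point YL Wp).
rewrite lt_neqAle addr_ge0 ?sqr_ge0 // andbT eq_sym.
by apply/eqP => /sum_sqr_eq0.
Qed.

Lemma normal_not_umbilic y l : conformal_spacelike y -> normal_section y l -> immersion l ->
  forall p, ~ umbilic l p.
Proof.
move=> cy nl il p [z [U [L [s [cz [lL Uz _] Up [_ E]]]]]].
have zp := Uz p Up.
have [W [Y [Wp WUz lY YL]]] := polar_pair_exists cy nl cz lL Up zp.
have reg := polar_regular il lL cz (fun q Wq => (WUz q Wq).1) YL Wp.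
have [_ oW Wz zY zL pt] := YL; apply: reg.
have HD b b' : form (D z b (D z b' L) p) (Y p) = - form (D z b' L p) (D z b Y p).
  apply/eqP; rewrite -addr_eq0; apply/eqP.
  exact: (form_D_const b cz.1 oW Wz (Cr_D b' (zL 2%N)) (zY 1%N) (fun q Wq => pp_DLY YL b' Wq) Wp).
have LY := pp_LY (pt p Wp).
move: E; rewrite (Dzz_formula cz.1 oW Wz zL Wp) addr0 /cpx scale_cvec.
rewrite !scaler0 subr0 add0r => E.
have Er := congr1 (@rvec R) E; have Ei := congr1 (@ivec R) E.
rewrite !rvec_cvec in Er; rewrite !ivec_cvec in Ei.
(* Paired with Y, the equation L_zz = -(s/2) L has right side 0; its real part gives m = 0 through
   the trace relation, its imaginary part n = 0. *)
have := congr1 (fun x : 'rV[R]_6 => form x (Y p)) Er.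
have := congr1 (fun x : 'rV[R]_6 => form x (Y p)) Ei.
rewrite /= !formZl formDl formNl formNl formZl LY !mulr0 !HD.
have := pp_trace (pt p Wp).
set m := form (D z false L p) _; set n := form (D z false L p) _; set m' := form _ _.
by move=> *; split; lra.
Qed.

(** Used to make Y canonical in [z] while keeping L. The terms in the derivative of g disappear
    because Y is orthogonal to L, to its own derivatives and to those of L. *)
Lemma polar_pair_scale z W Y L (g : M -> R) : polar_pair z W Y L ->
  (forall k, Cr z W k g) -> (forall q, W q -> 0 < g q) ->
  polar_pair z W (fun q => g q *: Y q) L.
Proof.
move=> YL zg g0; have [cz oW Wz zY zL pt] := YL.
split=> // [k|q Wq]; first exact: (Cr_scale cz oW Wz).
have E b : D z b (fun q => g q *: Y q) q = D z b g q *: Y q + g q *: D z b Y q.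
  by apply: isD_val; exact: (isD_scale cz (Wz _ Wq) (Cr_isD b (zg 1%N) Wq) (Cr_isD b (zY 1%N) Wq)).
have P := pt q Wq; have YD b := pp_YDY YL b Wq.
have DY b : form (D z b Y q) (Y q) = 0 by rewrite formC.
have EE b b' : form (D z b g q *: Y q + g q *: D z b Y q) (D z b' g q *: Y q + g q *: D z b' Y q) =
    g q * (g q * form (D z b Y q) (D z b' Y q)).
  by rewrite formDl !formDr !formZl !formZr (pp_YY P) YD DY !mulr0 !add0r.
split; rewrite ?E ?EE.
- by rewrite formZl formZr (pp_YY P) !mulr0.
- exact: pp_LL P.
- exact: pp_L0 P.
- by rewrite formZr (pp_LY P) mulr0.
- by move=> b; rewrite E formDr !formZr (pp_LY P) (pp_LDY P) !mulr0 addr0.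
- rewrite !formDr !formZr !(pp_DLY YL _ Wq) !mulr0 !add0r -mulrDr (pp_trace P).
  by rewrite mulr0.
- by rewrite (pp_iso P).
- by rewrite (pp_orth P) !mulr0.
- by rewrite !mulr_gt0 ?g0 ?(pp_pos P).
Qed.

Lemma canonical_lift_unit y z U Y q : canonical_lift y z U Y -> U q ->
  [/\ form (D z false Y q) (D z false Y q) = 1, form (D z true Y q) (D z true Y q) = 1 &
    form (D z false Y q) (D z true Y q) = 0].
Proof.
move=> [_ _ H] Uq; have := H q Uq; rewrite D_false D_true.
set u := D z false Y q; set v := D z true Y q => {}H.
have e1 : form u u = 1.
  by have := H 1 0; rewrite /= scale1r scale0r addr0 expr1n expr0n addr0.
have e2 : form v v = 1.
  by have := H 0 1; rewrite /= scale1r scale0r add0r expr1n expr0n add0r.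
split=> //; have := H 1 1; rewrite /= !scale1r formDl !formDr e1 e2 [form v u]formC expr1n.
by move=> *; lra.
Qed.

Section HopfExists.
Variables (z : lchart R M) (W : set M) (Y : M -> 'rV[R]_6).
Hypothesis cz : is_lchart z.
Hypothesis oW : open W.
Hypothesis Wz : W `<=` dom z.
Hypothesis zY : forall k, Cr z W k Y.
Hypothesis Ynull : forall q, W q -> form (Y q) (Y q) = 0.
Hypothesis Yunit : forall b q, W q -> form (D z b Y q) (D z b Y q) = 1.
Hypothesis Yorth : forall q, W q -> form (D z false Y q) (D z true Y q) = 0.

Let zDY b k : Cr z W k (D z b Y) := Cr_D b (zY k.+1).

Lemma null_D b q : W q -> form (Y q) (D z b Y q) = 0.
Proof. by move=> Wq; exact: (form_D_const0 b cz oW Wz (zY 1%N) Ynull Wq). Qed.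

Lemma null_DD b b' q : W q -> form (D z b (D z b' Y) q) (Y q) = - form (D z b Y q) (D z b' Y q).
Proof.
move=> Wq; apply/eqP; rewrite -addr_eq0 formC addrC; apply/eqP.
exact: (form_D_const b cz oW Wz (zY 1%N) (zDY b' 1%N) (null_D b') Wq).
Qed.

Lemma unit_DD b b' q : W q -> form (D z b (D z b' Y) q) (D z b' Y q) = 0.
Proof. by move=> Wq; rewrite formC; exact: (form_D_const0 b cz oW Wz (zDY b' 1%N) (Yunit b') Wq). Qed.

Lemma unit_DbDb b q : W q -> form (D z b (D z b Y) q) (D z (~~ b) Y q) = 0.
Proof.
move=> Wq; have H b' b'' : b'' = ~~ b' -> forall q', W q' -> form (D z b' Y q') (D z b'' Y q') = 0.
  by move=> -> q' Wq'; case: b'; rewrite /= ?[form (D z true Y q') _]formC Yorth.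
have := form_D_const b cz oW Wz (zDY b 1%N) (zDY (~~ b) 1%N) (H b (~~ b) erefl) Wq.
have -> : D z b (D z (~~ b) Y) q = D z (~~ b) (D z b Y) q.
  by have := D_comm cz oW Wz (zY 2%N) Wq; case: (b) => /= ->.
by rewrite [form (D z b Y q) _]formC unit_DD // addr0.
Qed.

Lemma null_laplacian q : W q -> form (Y q) (laplacian z Y q) = -2.
Proof.
move=> Wq; rewrite formDr ![form (Y q) _]formC !null_DD // !Yunit //.
by ring.
Qed.

(** [adapted] speaks of given Hopf data, so s and kappa must be produced before the hypothesis on
    the isothermic surface can be used. *)
Lemma hopf_exists p : W p -> exists s kappa, hopf z Y p s kappa /\
  ivec kappa = - (2^-1 *: D z true (D z false Y) p) + (complex.Im s / 2) *: Y p.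
Proof.
move=> Wp; pose T := D z false (D z false Y) p - D z true (D z true Y) p.
pose S := D z true (D z false Y) p; pose w := laplacian z Y p.
(* [T] and [S] are already orthogonal to Y and its derivatives. Since <Y,w> = -2, adding Y times
   half the pairing with [w] makes the sums orthogonal to [w] as well. *)
pose s1 : R := 4^-1 * form T w / 2; pose s2 : R := - (2^-1 * form S w / 2).
pose k1 := 4^-1 *: T + s1 *: Y p; pose k2 := - (2^-1 *: S) + s2 *: Y p.
have Yl : form (Y p) w = -2 := null_laplacian Wp.
have TY : form T (Y p) = 0 by rewrite /T formDl formNl !null_DD // !Yunit //; ring.
have SY : form S (Y p) = 0 by rewrite /S null_DD // formC Yorth // oppr0.
have TD b : form T (D z b Y p) = 0.
  by rewrite /T formDl formNl; case: b; rewrite unit_DD // ?(unit_DbDb true) ?(unit_DbDb false) // subr0.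
have SD b : form S (D z b Y p) = 0.
  case: b; last exact: unit_DD.
  by rewrite /S (D_comm cz oW Wz (zY 2%N) Wp); exact: unit_DD.
exists (2 * s1 +i* (2 * s2))%C, (cvec k1 k2); split; last first.
  by rewrite ivec_cvec /k2 /=; congr (_ + _ *: _); field.
split.
  rewrite /VperpC /= rvec_cvec ivec_cvec; split; apply/(VperpP cz Wz zY _ Wp); split.
  - by rewrite /k1 formDl !formZl TY Ynull // !mulr0 addr0.
  - by move=> b; rewrite /k1 formDl !formZl TD null_D // !mulr0 addr0.
  - by rewrite /k1 formDl !formZl -/w Yl /s1; field.
  - by rewrite /k2 formDl formNl !formZl SY Ynull // !mulr0 oppr0 addr0.
  - by move=> b; rewrite /k2 formDl formNl !formZl SD null_D // !mulr0 oppr0 addr0.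
  - by rewrite /k2 formDl formNl !formZl -/w Yl /s2; field.
rewrite (Dzz_formula cz oW Wz zY Wp) -/T -/S.
have -> : ((2 * s1 +i* (2 * s2)) / 2 = s1 +i* s2)%C.
  by rewrite half_complex; apply/eqP; rewrite eq_complex /=; apply/andP; split; apply/eqP; field.
rewrite scaleNr /cpx scale_cvec cvec_opp cvec_add !scaler0 subr0 add0r /k1 /k2.
by congr cvec; rewrite addrC addrK.
Qed.

End HopfExists.

Lemma conjv_real (x : 'rV[R[i]%C]_6) : x = conjv x <-> ivec x = 0.
Proof.
split=> [E|E]; apply/rowP => j.
  have := congr1 (fun t : 'rV[R[i]%C]_6 => complex.Im (t 0 j)) E; rewrite !mxE.
  by case: (x 0 j) => a c /= H; lra.
have := congr1 (fun t : 'rV[R]_6 => t 0 j) E; rewrite !mxE.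
by case: (x 0 j) => a c /= ->; rewrite oppr0.
Qed.

(** The given lift L is canonical in [z]; a lift of [y] canonical in the same [z] is built beside
    it, so that [pp_Luv] applies to the pair. *)
Lemma normal_adapted y l z : conformal_spacelike y -> normal_section y l ->
  adapted y z -> adapted l z.
Proof.
move=> cy nl [cz Hz]; split=> // U L p s kappa cL Up hL.
have [lL Uz _] := cL; have zp := Uz p Up.
have [W [Y0 [Wp WUz lY0 YL0]]] := polar_pair_exists cy nl cz lL Up zp.
have [_ oW Wz _ zL _] := YL0.
have [g []] := canonical_lift_near cy lY0 cz Wp zp; rewrite (setIidl Wz) => g0 zg cY.
set Y := fun q => g q *: Y0 q in cY.
have YL : polar_pair z W Y L := polar_pair_scale YL0 zg g0.
have zY := pp_Y YL; have pt := pp_point YL.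
have Yunit b q : W q -> form (D z b Y q) (D z b Y q) = 1.
  by move=> Wq; have [] := canonical_lift_unit cY Wq; case: b.
(* Im kappa = 0 for Y says that Y_uv = (Im s) Y. *)
have Yuv q : W q -> exists t, D z true (D z false Y) q = t *: Y q.
  move=> Wq; have [t [k [hk Ek]]] := hopf_exists cz.1 oW Wz zY (fun q Wq => pp_YY (pt q Wq)) Yunit
    (fun q Wq => pp_orth (pt q Wq)) Wq.
  have /conjv_real := Hz W Y q t k cY Wq hk; rewrite Ek => /eqP.
  rewrite addrC subr_eq0 => /eqP E; exists (complex.Im t).
  have := congr1 (fun x => 2 *: x) E; rewrite !scalerA mulfV ?pnatr_eq0 // scale1r => <-.
  by congr (_ *: _); field.
have WU q : W q -> U q by move=> /WUz[].
have Lunit q : W q -> form (D z false L q) (D z false L q) = 1.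
  by move=> Wq; have [] := canonical_lift_unit cL (WU q Wq).
have [w Ew] := pp_Luv YL (Yunit false) Lunit Yuv Wp.
have [[_ Vi] E] := hL.
have Ei := congr1 (@ivec R) E; move: Ei.
rewrite (Dzz_formula cz.1 oW Wz zL Wp) ivec_cvec Ew => Ei.
(* L_uv = w L makes Im kappa a multiple of L. It is also orthogonal to the Laplacian of L, whose
   product with L is -2, so it vanishes. *)
have [t Et] : exists t, ivec kappa = t *: L p.
  exists (complex.Im s / 2 - w / 2); apply/rowP => j.
  have := congr1 (fun x : 'rV[R]_6 => x 0 j) Ei; rewrite !mxE.
  rewrite half_complex; case: (s) => a c; case: (kappa 0 j) => k k' /= H.
  by lra.
apply/conjv_real; rewrite Et.
have := ((VperpP cz.1 Wz zL _ Wp).1 Vi).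
rewrite Et => -[_ _]; rewrite formZl.
have -> : form (L p) (laplacian z L p) = -2.
  apply: (null_laplacian cz.1 oW Wz zL (fun q Wq => pp_LL (pt q Wq)) _ Wp) => b q Wq.
  by have [] := canonical_lift_unit cL (WU q Wq); case: b.
by move=> H; have -> : t = 0 by [lra]; rewrite scale0r.
Qed.

Lemma normal_isothermic y l : isothermic y -> normal_section y l -> immersion l ->
  isothermic l /\ forall z, adapted y z -> adapted l z.
Proof.
move=> [cy _ ay] nl il; have ad z := @normal_adapted y l z cy nl.
split=> //; split; first exact: normal_conformal cy nl il.
  exact: normal_not_umbilic cy nl il.
by move=> p; have [z az zp] := ay p; exists z => //; exact: ad.
Qed.

End Isothermic.

Theorem theorem5p3 (R : realType) (o : bool) (M : riemannSurface R)
    (y : M -> quadric R) :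
  isothermic y ->
  (forall l : M -> quadric R, left_polar o y l -> immersion l ->
     isothermic l /\ (forall z : lchart R M, adapted y z -> adapted l z)) /\
  (forall r : M -> quadric R, right_polar o y r -> immersion r ->
     isothermic r /\ (forall z : lchart R M, adapted y z -> adapted r z)).
Proof.
move=> iy; split=> [l pl il|r pr ir].
  exact: normal_isothermic iy (left_polar_normal pl) il.
exact: normal_isothermic iy (right_polar_normal pr) ir.
Qed.
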